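(* Let $m\geq 2$ be any even integer. Then $$\int_0^1 \frac{(x+1)\log \left(x^{3 m}+1\right)}{x^3+1}\,dx=\frac{m}{12}\left(\psi'(5/6)-\psi'(1/3)\right)-\frac{\pi^2m}{9}-\frac{\pi m\sqrt{3}}{9}\log 2-\frac{2\pi\sqrt{3}}{9}\Bigg\{2\sum_{k=0}^{\frac{m}{2}-1}\log\left[\sin\left(\frac{1}{3}\sin^{-1}\left(\sqrt{\frac{\varphi_k+1}{2}}\right)\right)\right]-\sum_{k=0}^{\frac{m}{2}-1}\log \left[2 \cos \left(\frac{2}{3} \sin ^{-1}\left(\sqrt{\frac{1+\varphi_k}{2}}\right)\right)+1\right]-\sum_{k=0}^{\frac{m}{2}-1}\log\left(\varphi_k+1\right)\Bigg\}.$$ If $m\geq 1$ is an odd integer, then $$\int_0^1 \frac{(x+1)\log \left(x^{3 m}+1\right)}{x^3+1}\,dx=\frac{m}{12}\left(\psi'(5/6)-\psi'(1/3)\right)-\frac{\pi^2m}{9}+\frac{\pi\sqrt{3}}{3}\log 3-\frac{\pi(m-1)\sqrt{3}}{9}\log 2-\frac{2\pi\sqrt{3}}{9}\Bigg\{2\sum_{k=0}^{\frac{m-3}{2}}\log\left[\sin\left(\frac{1}{3}\sin^{-1}\left(\sqrt{\frac{\varphi_k+1}{2}}\right)\right)\right]-\sum_{k=0}^{\frac{m-3}{2}}\log \left[2 \cos \left(\frac{2}{3} \sin ^{-1}\left(\sqrt{\frac{1+\varphi_k}{2}}\right)\right)+1\right]-\sum_{k=0}^{\frac{m-3}{2}}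\log\left(1+\varphi_k\right)\Bigg\}.$$
   Context: $\psi=\Gamma'/\Gamma$ is the digamma function and $\psi'$ its derivative. For given $m$, $\varphi_k=\cos\left(\frac{(2k+1)\pi}{m}\right)$. $\sin^{-1}$ denotes the (principal) inverse sine. An empty sum $\sum_{k=0}^{-1}(\cdot)$ is taken to be zero. *)

(* Defs.v *)
From Stdlib Require Import Reals List.
From Coquelicot Require Import Coquelicot.
Open Scope R_scope.

(* Euler's integral, improper at both ends; it converges for every x > 0. *)
Definition Gamma (x : R) : R :=
  RInt_gen (fun t => Rpower t (x - 1) * exp (- t))
           (at_right 0) (Rbar_locally p_infty).

Definition digamma (x : R) : R := Derive Gamma x / Gamma x.

Definition trigamma (x : R) : R := Derive digamma x.

Definition phi (m k : nat) : R := cos ((2 * INR k + 1) * PI / INR m).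

(* f 0 + ... + f (n - 1), with n terms.  Unlike [sum_f_R0] or [sum_n], it
   allows the empty sum. *)
Definition sum_lt (n : nat) (f : nat -> R) : R :=
  fold_right Rplus 0 (map f (List.seq 0 n)).

(* Main.v *)
Require Import Defs.
From Stdlib Require Import Reals List Lra Lia.
From Coquelicot Require Import Coquelicot.
Open Scope R_scope.

(* Since (x + 1) / (x^3 + 1) = 1 / (x^2 - x + 1), factoring 1 + y^m at y = x^3 reduces
   the integral to J(th) = int_0^1 log(x^6 - 2 cos th x^3 + 1) / (x^2 - x + 1) dx at the
   angles th = (2k+1) PI / m, plus J(PI) / 2 when m is odd.  Differentiating in th and
   splitting into partial fractions over the angles th/3, (2 PI +- th)/3, the terms linear
   in th cancel, because p'(1) = 0 for p(y) = y^3 - 3 y - 2 cos th = prod (y - 2 cos a_j);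
   hence J(th) = J(PI) + (2 PI / sqrt 3) log ((1 + 2 cos ((PI - th)/3)) / 3).
   The substitution x = sin (PI/3 - u) / sin (PI/3 + u) turns J(PI) into integrals of
   log (2 cos u) up to PI/3 and PI/6, whose Fourier series are combinations of
   S_r = sum_j 1 / (6j + r)^2; these are the trigamma values trigamma (r/6) / 36, by
   Bohr-Mollerup and termwise differentiation.  The duplications 4 S_2 = S_1 + S_4,
   4 S_4 = S_2 + S_5 and the Basel sum S_1 - S_2 - S_4 + S_5 = 2 PI^2 / 27 eliminate all
   but S_2 and S_5. *)

(** * The Gamma function *)

(** In [w = x + 1/x] the th-derivative of the integrand of J is [2 sin th / (x p(w) (w - 1))],
    because [x^3 + 1/x^3 = w^3 - 3 w]. As [p'(2 cos a) = 3 sin (3 a) / sin a], the root [2 cos a_j]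
    gets the coefficient [2 sin a_j / (3 (2 cos a_j - 1))], negated for [(2 PI - th)/3], where
    [sin (3 a_j) = - sin th]. The integral of [sin a / (x^2 - 2 x cos a + 1)] is [(PI - a) / 2], so
    the part linear in th is a multiple of the sum of [1 / (2 cos a_j - 1)], which is
    [- p'(1) / p(1) = 0]; what remains integrates to a single logarithm. The substitution in J(PI)
    is the one that turns [dx / (x^2 - x + 1)] into a constant times [du]. Termwise integration of
    the Fourier series rests on an explicit O(1/N) error bound, uniform on [[0, PI/3]], away from
    the singularity at [PI/2]; both evaluation points lie in that interval. [trigamma] is a
    derivative of a quotient built from an improper integral, so its series has to be extracted from
    the convexity and the functional equation of [Gamma]. *)

Lemma locally_open_interval (a b x : R) (P : R -> Prop) :
  a < x < b -> (forall y, a < y < b -> P y) -> locally x P.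
Proof.
  intros Hx HP. apply (locally_interval P x a b); simpl; try lra.
  intros y Ha Hb. apply HP. split; assumption.
Qed.

Lemma ex_RInt_pos (f : R -> R) (a b : R) :
  (forall t, 0 < t -> continuous f t) -> 0 < a -> a <= b -> ex_RInt f a b.
Proof.
  intros Hc Ha Hab. apply (ex_RInt_continuous (V := R_CompleteNormedModule)).
  intros z. rewrite Rmin_left, Rmax_right by lra. intros; apply Hc; lra.
Qed.

(** The proper integrals grow with the interval, so the improper integral is their supremum. Keeping
    the least-upper-bound property lets inequalities between proper integrals pass to [Gamma]. *)
Lemma is_RInt_gen_nonneg (f : R -> R) (M : R) :
  (forall t, 0 < t -> 0 <= f t) ->
  (forall t, 0 < t -> continuous f t) ->
  (forall a b, 0 < a -> a <= b -> RInt f a b <= M) ->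
  exists l, is_RInt_gen f (at_right 0) (Rbar_locally p_infty) l /\
    (forall a b, 0 < a -> a <= b -> RInt f a b <= l) /\
    (forall M', (forall a b, 0 < a -> a <= b -> RInt f a b <= M') -> l <= M').
Proof.
  intros H0 Hc HM.
  assert (Hex := fun a b => ex_RInt_pos f a b Hc).
  destruct (completeness (fun y => exists a b, 0 < a /\ a <= b /\ y = RInt f a b))
    as [l [Hub Hlub]].
  { exists M. intros y (a & b & Ha & Hab & ->). now apply HM. }
  { exists (RInt f 1 1), 1, 1. repeat split; lra. }
  assert (Hle : forall a b, 0 < a -> a <= b -> RInt f a b <= l).
  { intros a b Ha Hab. apply Hub. now exists a, b. }
  exists l. split; [|split; [exact Hle|]].
  2:{ intros M' HM'. apply Hlub. intros y (a & b & Ha & Hab & ->). now apply HM'. }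
  unfold is_RInt_gen.
  apply (filterlimi_locally (F := filter_prod (at_right 0) (Rbar_locally p_infty))
           (fun ab : R * R => is_RInt f (fst ab) (snd ab)) l).
  intros eps.
  assert (Hn : exists a0 b0, 0 < a0 /\ a0 <= b0 /\ l - eps < RInt f a0 b0).
  { destruct (Classical_Prop.classic
      (exists a0 b0, 0 < a0 /\ a0 <= b0 /\ l - eps < RInt f a0 b0)) as [H|H]; [exact H|].
    exfalso. assert (l <= l - eps).
    { apply Hlub. intros y (a & b & Ha & Hab & ->). apply Rnot_lt_le. intros Hlt.
      apply H. now exists a, b. }
    destruct eps as [e He]; simpl in *; lra. }
  destruct Hn as (a0 & b0 & Ha0 & Hab0 & Hl).
  (* Every interval containing the nearly optimal [[a0, b0]] has its integral between [l - eps] and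
     [l]. *)
  exists (fun a => 0 < a < a0) (fun b => b0 < b).
  - exists (mkposreal a0 Ha0). intros y Hy Hy0. simpl in *.
    unfold ball in Hy; simpl in Hy; unfold AbsRing_ball, abs, minus, plus, opp in Hy;
      simpl in Hy. split; [lra|]. apply Rabs_def2 in Hy. lra.
  - now exists b0.
  - intros a b [Ha1 Ha2] Hb. exists (RInt f a b). simpl. split.
    + apply (RInt_correct (V := R_CompleteNormedModule)). apply Hex; lra.
    + assert (RInt f a b = RInt f a a0 + RInt f a0 b0 + RInt f b0 b) as E.
      { rewrite <- (RInt_Chasles f a b0 b), <- (RInt_Chasles f a a0 b0).
        - reflexivity.
        - apply Hex; lra.
        - apply Hex; lra.
        - apply Hex; lra.
        - apply Hex; lra. }
      assert (0 <= RInt f a a0).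
      { apply RInt_ge_0; [lra|apply Hex; lra|]. intros; apply H0; lra. }
      assert (0 <= RInt f b0 b).
      { apply RInt_ge_0; [lra|apply Hex; lra|]. intros; apply H0; lra. }
      assert (RInt f a b <= l) by (apply Hle; lra).
      unfold ball; simpl; unfold AbsRing_ball, abs, minus, plus, opp; simpl.
      apply Rabs_def1; destruct eps as [e He]; simpl in *; lra.
Qed.

Definition gamma_integrand (x t : R) : R := Rpower t (x - 1) * exp (- t).

Lemma gamma_integrand_pos (x t : R) : 0 < gamma_integrand x t.
Proof. apply Rmult_lt_0_compat; apply exp_pos. Qed.

Lemma gamma_integrand_continuous (x t : R) : 0 < t -> continuous (gamma_integrand x) t.
Proof.
  intros Ht. apply (ex_derive_continuous (K := R_AbsRing) (V := R_NormedModule)).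
  unfold gamma_integrand, Rpower. auto_derive. assumption.
Qed.

(** The constant is the maximum of [t^p exp(-t)], attained at [t = p]; the bound is [ln s <= s - 1]
    at [s = t / p]. *)
Lemma Rpower_le_exp (p t : R) : 0 < p -> 0 < t -> Rpower t p <= exp (p * ln p - p) * exp t.
Proof.
  intros Hp Ht. unfold Rpower. rewrite <- exp_plus.
  assert (ln (t / p) <= t / p - 1).
  { assert (0 < t / p) by (apply Rdiv_lt_0_compat; lra).
    rewrite <- (ln_exp (t / p - 1)).
    apply ln_le; [assumption|]. generalize (exp_ineq1_le (t / p - 1)); lra. }
  rewrite ln_div in H by assumption.
  assert (p * (ln t - ln p) <= p * (t / p - 1)) by (apply Rmult_le_compat_l; lra).
  replace (p * (t / p - 1)) with (t - p) in H0 by (field; lra).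
  destruct (Req_dec (p * ln t) (p * ln p - p + t)) as [->|]; [lra|].
  left. apply exp_increasing. lra.
Qed.

(* The dominating function [x t^(x-1) / (1 + t^x)^2] is the derivative of the
   bounded function [- 1 / (1 + t^x)] on the whole half-line. *)
Lemma RInt_gamma_integrand_bound (x : R) : 0 < x ->
  exists M, forall a b, 0 < a -> a <= b -> RInt (gamma_integrand x) a b <= M.
Proof.
  intros Hx.
  (* [C] is chosen for [(1 + t^x)^2 <= C exp t]: use [(1 + u)^2 <= 2 (1 + u^2)], [1 <= exp t] and
     the maximum of [t^(2x) exp(-t)]. *)
  set (C := 2 * (1 + exp (2 * x * ln (2 * x) - 2 * x))).
  assert (HC : 0 < C) by (unfold C; generalize (exp_pos (2 * x * ln (2 * x) - 2 * x)); lra).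
  exists (C / x). intros a b Ha Hab.
  set (g := fun t => C * (Rpower t (x - 1) / (1 + Rpower t x) ^ 2)).
  assert (Hp : forall t, 0 < Rpower t x) by (intros; apply exp_pos).
  assert (Hg : is_RInt g a b (minus (- (C / x) / (1 + Rpower b x)) (- (C / x) / (1 + Rpower a x)))).
  { apply (is_RInt_derive (fun t => - (C / x) / (1 + Rpower t x))).
    - intros t. rewrite Rmin_left, Rmax_right by lra. intros Ht.
      unfold g. replace (Rpower t (x - 1)) with (Rpower t x / t).
      2:{ replace (x - 1) with (x + - (1)) by ring. rewrite Rpower_plus, Rpower_Ropp, Rpower_1 by lra. reflexivity. }
      unfold Rpower in *. auto_derive.
      + split; [lra|]. split; [|trivial]. generalize (Hp t). unfold Rpower. lra.
      + field. generalize (Hp t). unfold Rpower. intros; repeat split; lra.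
    - intros t. rewrite Rmin_left, Rmax_right by lra. intros Ht.
      apply (ex_derive_continuous (K := R_AbsRing) (V := R_NormedModule)).
      unfold g, Rpower. auto_derive. split; [lra|]. split; [lra|]. split; [|trivial].
      generalize (Hp t). unfold Rpower. intros; nra. }
  apply Rle_trans with (RInt g a b).
  - apply RInt_le; [assumption| |exists (minus (- (C / x) / (1 + Rpower b x)) (- (C / x) / (1 + Rpower a x))); exact Hg|].
    + apply ex_RInt_pos; [apply gamma_integrand_continuous|assumption|assumption].
    + intros t Ht. unfold g, gamma_integrand.
      rewrite (Rmult_comm C). unfold Rdiv. rewrite Rmult_assoc.
      apply Rmult_le_compat_l; [left; apply exp_pos|].
      specialize (Hp t).
      assert (0 < (1 + Rpower t x) ^ 2) by (apply pow_lt; lra).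
      apply Rmult_le_reg_l with ((1 + Rpower t x) ^ 2); [assumption|].
      replace ((1 + Rpower t x) ^ 2 * (/ (1 + Rpower t x) ^ 2 * C)) with C by (field; lra).
      apply Rmult_le_reg_r with (exp t); [apply exp_pos|].
      rewrite Rmult_assoc, <- exp_plus. replace (- t + t) with 0 by ring. rewrite exp_0.
      assert (H2 : Rpower t x * Rpower t x = Rpower t (2 * x)).
      { rewrite <- Rpower_plus. f_equal. ring. }
      assert (Rpower t (2 * x) <= exp (2 * x * ln (2 * x) - 2 * x) * exp t)
        by (apply Rpower_le_exp; lra).
      assert (1 <= exp t) by (generalize (exp_ineq1_le t); lra).
      assert (0 <= (1 - Rpower t x) ^ 2) by apply pow2_ge_0.
      unfold C. set (K := exp (2 * x * ln (2 * x) - 2 * x)) in *. lra.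
  - rewrite (is_RInt_unique _ _ _ _ Hg). unfold minus, plus, opp; simpl.
    generalize (Hp a) (Hp b); intros.
    assert (0 < C / x) by (apply Rdiv_lt_0_compat; lra).
    assert (0 < C / x * / (1 + Rpower b x)) by (apply Rmult_lt_0_compat; [|apply Rinv_0_lt_compat]; lra).
    assert (C / x * / (1 + Rpower a x) <= C / x * 1).
    { apply Rmult_le_compat_l; [lra|]. rewrite <- Rinv_1. apply Rinv_le_contravar; lra. }
    unfold Rdiv at 1 3. lra.
Qed.

Lemma Gamma_spec (x : R) : 0 < x ->
  is_RInt_gen (gamma_integrand x) (at_right 0) (Rbar_locally p_infty) (Gamma x) /\
  (forall a b, 0 < a -> a <= b -> RInt (gamma_integrand x) a b <= Gamma x) /\
  (forall M, (forall a b, 0 < a -> a <= b -> RInt (gamma_integrand x) a b <= M) -> Gamma x <= M).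
Proof.
  intros Hx. destruct (RInt_gamma_integrand_bound x Hx) as [M HM].
  destruct (is_RInt_gen_nonneg (gamma_integrand x) M) as (l & H1 & H2 & H3).
  - intros t _. left; apply gamma_integrand_pos.
  - apply gamma_integrand_continuous.
  - assumption.
  - assert (Gamma x = l) as ->; [|now repeat split].
    unfold Gamma.
    apply (is_RInt_gen_unique (V := R_CompleteNormedModule)
             (Fa := at_right 0) (Fb := Rbar_locally p_infty)).
    exact H1.
Qed.

Lemma Gamma_pos (x : R) : 0 < x -> 0 < Gamma x.
Proof.
  intros Hx. destruct (Gamma_spec x Hx) as (_ & H & _).
  apply Rlt_le_trans with (RInt (gamma_integrand x) 1 2); [|apply H; lra].
  apply RInt_gt_0; [lra| |].
  - intros; apply gamma_integrand_pos.
  - intros t Ht. apply gamma_integrand_continuous; lra.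
Qed.

Lemma gamma_boundary_at_0 (x : R) : 0 < x ->
  filterlim (fun t => Rpower t x * exp (- t)) (at_right 0) (locally 0).
Proof.
  intros Hx. apply filterlim_locally. intros eps.
  assert (He : 0 < Rpower eps (/ x)) by apply exp_pos.
  exists (mkposreal _ He). intros t Ht Ht0.
  unfold ball in *; simpl in *; unfold AbsRing_ball, abs, minus, plus, opp in *; simpl in *.
  apply Rabs_def2 in Ht.
  assert (Rpower t x < eps).
  { replace (pos eps) with (Rpower (Rpower eps (/ x)) x).
    - apply Rlt_Rpower_l; lra.
    - rewrite Rpower_mult, Rinv_l, Rpower_1 by (try lra; apply cond_pos). reflexivity. }
  assert (0 < Rpower t x) by apply exp_pos.
  assert (exp (- t) <= 1) by (rewrite <- exp_0; left; apply exp_increasing; lra).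
  assert (0 < exp (- t)) by apply exp_pos.
  apply Rabs_def1; nra.
Qed.

Lemma gamma_boundary_at_infty (x : R) : 0 < x ->
  filterlim (fun t => Rpower t x * exp (- t)) (Rbar_locally p_infty) (locally 0).
Proof.
  intros Hx. apply filterlim_locally. intros eps.
  (* Bounding the next power, [t^(x+1) <= C exp t], leaves a factor [1 / t] that tends to 0. *)
  set (C := exp ((x + 1) * ln (x + 1) - (x + 1))).
  assert (HC : 0 < C) by apply exp_pos.
  assert (He := cond_pos eps).
  exists (C / eps). intros t Ht.
  assert (0 < C / eps) by (apply Rdiv_lt_0_compat; lra).
  assert (H1 : Rpower t (x + 1) <= C * exp t) by (apply Rpower_le_exp; lra).
  rewrite Rpower_plus, Rpower_1 in H1 by lra.
  unfold ball; simpl; unfold AbsRing_ball, abs, minus, plus, opp; simpl.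
  assert (0 < Rpower t x) by apply exp_pos.
  assert (0 < exp (- t)) by apply exp_pos.
  assert (E : exp t * exp (- t) = 1) by (rewrite <- exp_plus, Rplus_opp_r; apply exp_0).
  assert (H3 : Rpower t x * exp (- t) * t <= C).
  { apply (Rmult_le_compat_r (exp (- t))) in H1; [|lra].
    rewrite (Rmult_assoc C), E in H1. lra. }
  assert (C < eps * t).
  { apply (Rmult_lt_compat_l eps) in Ht; [|lra].
    replace (eps * (C / eps)) with C in Ht by (field; lra). exact Ht. }
  assert (0 < Rpower t x * exp (- t)) by (apply Rmult_lt_0_compat; assumption).
  apply Rabs_def1; [|lra].
  apply Rmult_lt_reg_r with t; lra.
Qed.

(** Integration by parts: [F = t^x exp(-t)] vanishes at both ends, so the improper integral of its
    derivative is 0. *)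
Lemma Gamma_succ (x : R) : 0 < x -> Gamma (x + 1) = x * Gamma x.
Proof.
  intros Hx.
  destruct (Gamma_spec x Hx) as (H1 & _).
  destruct (Gamma_spec (x + 1)) as (H2 & _); [lra|].
  set (F := fun t => Rpower t x * exp (- t)).
  assert (HD : forall t, 0 < t ->
    is_derive F t (x * gamma_integrand x t - gamma_integrand (x + 1) t)).
  { intros t Ht. unfold F, gamma_integrand.
    replace (x + 1 - 1) with x by ring.
    replace (Rpower t (x - 1)) with (Rpower t x / t).
    2:{ replace (x - 1) with (x + - (1)) by ring. rewrite Rpower_plus, Rpower_Ropp, Rpower_1 by lra. reflexivity. }
    unfold Rpower. auto_derive; [assumption|]. field. lra. }
  assert (Hpos : filter_prod (at_right 0) (Rbar_locally p_infty)
            (fun ab : R * R => forall t,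
               Rmin (fst ab) (snd ab) <= t <= Rmax (fst ab) (snd ab) -> 0 < t)).
  { exists (fun a => 0 < a) (fun b => 1 < b).
    - exists (mkposreal 1 Rlt_0_1). now intros y _ Hy.
    - now exists 1.
    - intros a b Ha Hb t [Ht _]. simpl in *.
      apply Rlt_le_trans with (Rmin a b); [|assumption]. apply Rmin_case; lra. }
  assert (H3 : is_RInt_gen (Derive F) (at_right 0) (Rbar_locally p_infty) (0 - 0)).
  { apply is_RInt_gen_Derive.
    - revert Hpos. apply filter_imp. intros ab H t Ht. eexists. apply HD. now apply H.
    - revert Hpos. apply filter_imp. intros ab H t Ht.
      assert (Ht' := H t Ht).
      apply continuous_ext_loc with
        (g := fun t => x * gamma_integrand x t - gamma_integrand (x + 1) t).
      + apply (locally_open_interval 0 (t + 1)); [lra|]. intros y Hy.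
        symmetry. apply is_derive_unique, HD. lra.
      + apply (continuous_minus (V := R_NormedModule)).
        * apply (continuous_scal_r (V := R_NormedModule)). now apply gamma_integrand_continuous.
        * now apply gamma_integrand_continuous.
    - now apply gamma_boundary_at_0.
    - now apply gamma_boundary_at_infty. }
  assert (H4 : is_RInt_gen (Derive F) (at_right 0) (Rbar_locally p_infty)
            (minus (scal x (Gamma x)) (Gamma (x + 1)))).
  { apply is_RInt_gen_ext with
      (f := fun t => minus (scal x (gamma_integrand x t)) (gamma_integrand (x + 1) t)).
    - revert Hpos. apply filter_imp. intros ab H t Ht. symmetry.
      apply is_derive_unique, HD. apply H. lra.
    - apply (is_RInt_gen_minus (V := R_NormedModule)); [|exact H2].
      now apply (is_RInt_gen_scal (V := R_NormedModule)). }
  apply (is_RInt_gen_unique (V := R_CompleteNormedModule)) in H3, H4.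
  rewrite H3 in H4. unfold minus, scal, plus, opp, mult in H4; simpl in H4.
  unfold mult in H4; simpl in H4. lra.
Qed.

(** At [u] and [v] the graph of [exp] lies above its tangent at the intermediate point [w], and the
    two tangent values average to [exp w]. *)
Lemma exp_convex (l u v : R) : 0 <= l <= 1 ->
  exp (l * u + (1 - l) * v) <= l * exp u + (1 - l) * exp v.
Proof.
  intros Hl. set (w := l * u + (1 - l) * v).
  assert (Hu : exp w * (1 + (u - w)) <= exp u).
  { replace u with (w + (u - w)) at 2 by ring. rewrite exp_plus.
    apply Rmult_le_compat_l; [left; apply exp_pos|apply exp_ineq1_le]. }
  assert (Hv : exp w * (1 + (v - w)) <= exp v).
  { replace v with (w + (v - w)) at 2 by ring. rewrite exp_plus.
    apply Rmult_le_compat_l; [left; apply exp_pos|apply exp_ineq1_le]. }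
  apply (Rmult_le_compat_l l) in Hu; [|lra].
  apply (Rmult_le_compat_l (1 - l)) in Hv; [|lra].
  replace (exp w) with (l * (exp w * (1 + (u - w))) + (1 - l) * (exp w * (1 + (v - w))))
    by (unfold w; ring).
  lra.
Qed.

(* Hölder's inequality, by integrating Young's inequality for the
   integrands normalized to have integral 1. *)
Lemma ln_Gamma_convex (l x y : R) : 0 <= l <= 1 -> 0 < x -> 0 < y ->
  ln (Gamma (l * x + (1 - l) * y)) <= l * ln (Gamma x) + (1 - l) * ln (Gamma y).
Proof.
  intros Hl Hx Hy. set (z := l * x + (1 - l) * y).
  assert (Hz : 0 < z).
  { unfold z. destruct (Req_dec l 0) as [->|]; [lra|].
    apply Rplus_lt_le_0_compat; [apply Rmult_lt_0_compat|apply Rmult_le_pos]; lra. }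
  assert (HA := Gamma_pos x Hx). assert (HB := Gamma_pos y Hy).
  destruct (Gamma_spec x Hx) as (_ & Hx2 & _).
  destruct (Gamma_spec y Hy) as (_ & Hy2 & _).
  destruct (Gamma_spec z Hz) as (_ & _ & Hz3).
  set (A := Gamma x) in *. set (B := Gamma y) in *.
  (* [c] is the bound [A^l B^(1-l)]; [exp_convex] is applied below to the logarithms of the
     integrands divided by [A] and [B]. *)
  set (c := exp (l * ln A + (1 - l) * ln B)).
  rewrite <- (ln_exp (l * ln A + (1 - l) * ln B)). fold c.
  apply ln_le; [now apply Gamma_pos|].
  assert (Hc : 0 < c) by apply exp_pos.
  assert (Hpt : forall t, 0 < t -> gamma_integrand z t <=
            c * l / A * gamma_integrand x t + c * (1 - l) / B * gamma_integrand y t).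
  { intros t Ht.
    assert (E : forall s, gamma_integrand s t = exp ((s - 1) * ln t - t)).
    { intros s. unfold gamma_integrand, Rpower. rewrite <- exp_plus. f_equal; ring. }
    rewrite !E.
    assert (H := exp_convex l ((x - 1) * ln t - t - ln A) ((y - 1) * ln t - t - ln B) Hl).
    replace (l * ((x - 1) * ln t - t - ln A) + (1 - l) * ((y - 1) * ln t - t - ln B))
      with (((z - 1) * ln t - t) + - (l * ln A + (1 - l) * ln B)) in H
      by (unfold z; ring).
    assert (ED : forall u v, 0 < v -> exp (u - ln v) = exp u / v).
    { intros u v Hv. unfold Rminus. rewrite exp_plus, exp_Ropp, exp_ln by assumption.
      reflexivity. }
    rewrite !ED, exp_plus, exp_Ropp in H by assumption. fold c in H.
    apply (Rmult_le_compat_l c) in H; [|lra].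
    replace (c * (exp ((z - 1) * ln t - t) * / c)) with (exp ((z - 1) * ln t - t)) in H
      by (field; lra).
    eapply Rle_trans; [exact H|]. right. field. lra. }
  assert (Hex : forall s a b, 0 < a -> a <= b -> ex_RInt (gamma_integrand s) a b).
  { intros s a b. apply ex_RInt_pos, gamma_integrand_continuous. }
  apply Hz3. intros a b Ha Hab.
  set (X := RInt (gamma_integrand x) a b). set (Y := RInt (gamma_integrand y) a b).
  assert (HI : is_RInt (fun t => c * l / A * gamma_integrand x t
                  + c * (1 - l) / B * gamma_integrand y t) a b
                (c * l / A * X + c * (1 - l) / B * Y)).
  { apply (is_RInt_plus (V := R_NormedModule)); apply (is_RInt_scal (V := R_NormedModule));
      apply (RInt_correct (V := R_CompleteNormedModule)); now apply Hex. }
  apply Rle_trans with (c * l / A * X + c * (1 - l) / B * Y).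
  - rewrite <- (is_RInt_unique _ _ _ _ HI). apply RInt_le; [assumption|now apply Hex| |].
    + eexists; exact HI.
    + intros t Ht. apply Hpt. lra.
  - assert (HX : X <= A) by (apply Hx2; assumption).
    assert (HY : Y <= B) by (apply Hy2; assumption).
    assert (0 <= c * l / A) by (apply Rmult_le_pos; [nra|left; now apply Rinv_0_lt_compat]).
    assert (0 <= c * (1 - l) / B) by (apply Rmult_le_pos; [nra|left; now apply Rinv_0_lt_compat]).
    assert (c * l / A * X <= c * l / A * A) by (apply Rmult_le_compat_l; assumption).
    assert (c * (1 - l) / B * Y <= c * (1 - l) / B * B) by (apply Rmult_le_compat_l; assumption).
    replace (c * l / A * A) with (c * l) in * by (field; lra).
    replace (c * (1 - l) / B * B) with (c * (1 - l)) in * by (field; lra).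
    lra.
Qed.

(** * The trigamma series *)

Lemma sum_lt_S (n : nat) (f : nat -> R) : sum_lt (S n) f = sum_lt n f + f n.
Proof.
  unfold sum_lt. rewrite seq_S, map_app, fold_right_app. simpl.
  generalize (map f (List.seq 0 n)). intros l.
  induction l as [|a l IH]; simpl; [ring|]. rewrite IH. ring.
Qed.

Lemma sum_lt_ext (n : nat) (f g : nat -> R) :
  (forall k, (k < n)%nat -> f k = g k) -> sum_lt n f = sum_lt n g.
Proof.
  induction n as [|n IH]; intros H; [reflexivity|].
  rewrite !sum_lt_S, IH, H by (intros; try apply H; lia). reflexivity.
Qed.

Lemma sum_lt_lin (n : nat) (a b : R) (f g : nat -> R) :
  sum_lt n (fun k => a * f k + b * g k) = a * sum_lt n f + b * sum_lt n g.
Proof.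
  induction n as [|n IH]; [unfold sum_lt; simpl; ring|].
  rewrite !sum_lt_S, IH. ring.
Qed.

Lemma sum_lt_scal (n : nat) (a : R) (f : nat -> R) :
  sum_lt n (fun k => a * f k) = a * sum_lt n f.
Proof.
  rewrite (sum_lt_ext n _ (fun k => a * f k + 0 * f k)) by (intros; ring).
  rewrite sum_lt_lin. ring.
Qed.

Lemma is_derive_sum_lt (n : nat) (f df : nat -> R -> R) (x : R) :
  (forall k, (k < n)%nat -> is_derive (f k) x (df k x)) ->
  is_derive (fun y => sum_lt n (fun k => f k y)) x (sum_lt n (fun k => df k x)).
Proof.
  induction n as [|n IH]; intros H.
  - apply (is_derive_const (V := R_NormedModule) 0 x).
  - rewrite sum_lt_S.
    apply is_derive_ext with (fun y => sum_lt n (fun k => f k y) + f n y).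
    { intros y. now rewrite sum_lt_S. }
    apply (is_derive_plus (V := R_NormedModule)); [apply IH; intros|]; apply H; lia.
Qed.

Lemma inv_succ_lim : is_lim_seq (fun n => / INR (S n)) 0.
Proof.
  apply -> (is_lim_seq_incr_1 (fun n => / INR n)).
  apply (is_lim_seq_inv INR p_infty); [apply is_lim_seq_INR|discriminate].
Qed.

(** The increments are bounded by a telescoping difference, so the tail after [n] is at most
    [C / (n + 1)]. When [u] depends on a parameter and [C] does not, this gives uniform
    convergence. *)
Lemma telescoping_Cauchy (u : nat -> R) (C : R) :
  (forall n, Rabs (u (S n) - u n) <= C * (/ INR (S n) - / INR (S (S n)))) ->
  exists l : R, is_lim_seq u l /\ forall n, Rabs (l - u n) <= C * / INR (S n).
Proof.
  intros H.
  assert (HC : 0 <= C).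
  { specialize (H O). generalize (Rabs_pos (u 1%nat - u O)).
    simpl in H. replace (/ 1 - / (1 + 1)) with (/ 2) in H by field. lra. }
  assert (HN : forall n p, Rabs (u (n + p)%nat - u n) <= C * (/ INR (S n) - / INR (S (n + p)))).
  { intros n p. induction p as [|p IH].
    - rewrite Nat.add_0_r, !Rminus_diag, Rabs_R0. lra.
    - rewrite Nat.add_succ_r. specialize (H (n + p)%nat).
      replace (u (S (n + p)) - u n) with ((u (S (n + p)) - u (n + p)%nat) + (u (n + p)%nat - u n)) by ring.
      eapply Rle_trans; [apply Rabs_triang|]. lra. }
  assert (HP : forall n, 0 < / INR (S n)).
  { intros n. apply Rinv_0_lt_compat, lt_0_INR. lia. }
  assert (HB : forall n p, (n <= p)%nat -> Rabs (u p - u n) <= C * / INR (S n)).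
  { intros n p Hp. replace p with (n + (p - n))%nat by lia.
    eapply Rle_trans; [apply HN|]. specialize (HP (n + (p - n))%nat). nra. }
  assert (Hcv : ex_finite_lim_seq u).
  { apply ex_lim_seq_cauchy_corr. intros eps.
    assert (Hl : is_lim_seq (fun n => (C + C) * / INR (S n)) 0).
    { replace (Finite 0) with (Rbar_mult (C + C) 0) by (simpl; f_equal; ring).
      apply (is_lim_seq_scal_l _ (C + C) 0), inv_succ_lim. }
    apply is_lim_seq_spec in Hl. destruct (Hl eps) as [N HN'].
    exists N. intros p q Hp Hq. specialize (HN' N (le_n N)).
    rewrite Rminus_0_r in HN'. apply Rabs_def2 in HN'.
    replace (u p - u q) with ((u p - u N) + - (u q - u N)) by ring.
    eapply Rle_lt_trans; [apply Rabs_triang|]. rewrite Rabs_Ropp.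
    generalize (HB N p Hp) (HB N q Hq). lra. }
  destruct Hcv as [l Hl]. exists l. split; [assumption|]. intros n.
  assert (Hl' : is_lim_seq (fun p => Rabs (u (p + n)%nat - u n)) (Rabs (l - u n))).
  { apply (is_lim_seq_abs _ (l - u n)).
    apply (is_lim_seq_minus' _ _ l (u n)); [|apply is_lim_seq_const].
    now apply is_lim_seq_incr_n. }
  apply (is_lim_seq_le _ (fun _ => C * / INR (S n)) (Rabs (l - u n)) (C * / INR (S n)))
    in Hl'; [assumption| |apply is_lim_seq_const].
  intros p. apply HB. lia.
Qed.

(** Termwise differentiation, with the limit [D] of the derivatives produced rather than given. It
    is used twice: from [ln Gamma] to [digamma], then with that [D] as [F], to [trigamma]. *)
Lemma is_derive_lim (f d : nat -> R -> R) (F : R -> R) (c : R) (r : posreal) (C : R) :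
  (forall n y, Boule c r y -> is_derive (f n) y (d n y)) ->
  (forall y, Boule c r y -> is_lim_seq (fun n => f n y) (F y)) ->
  (forall n y, Boule c r y ->
     Rabs (d (S n) y - d n y) <= C * (/ INR (S n) - / INR (S (S n)))) ->
  exists D : R -> R, forall y, Boule c r y ->
    is_lim_seq (fun n => d n y) (D y) /\ is_derive F y (D y).
Proof.
  intros Hd Hf Hb.
  exists (fun y => real (Lim_seq (fun n => d n y))).
  assert (HD : forall y, Boule c r y ->
     is_lim_seq (fun n => d n y) (real (Lim_seq (fun n => d n y))) /\
     forall n, Rabs (real (Lim_seq (fun n => d n y)) - d n y) <= C * / INR (S n)).
  { intros y Hy. destruct (telescoping_Cauchy (fun n => d n y) C) as [l [H1 H2]].
    - intros n. now apply Hb.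
    - rewrite (is_lim_seq_unique _ _ H1). split; [exact H1|exact H2]. }
  intros y Hy. split; [now apply HD|]. apply is_derive_Reals.
  assert (HU : CVU d (fun y => real (Lim_seq (fun n => d n y))) c r).
  { intros eps Heps.
    assert (Hl : is_lim_seq (fun n => C * / INR (S n)) 0).
    { replace (Finite 0) with (Rbar_mult C 0) by (simpl; f_equal; ring).
      apply (is_lim_seq_scal_l _ C 0), inv_succ_lim. }
    apply is_lim_seq_spec in Hl. destruct (Hl (mkposreal eps Heps)) as [N HN].
    exists N. intros n z Hn Hz. specialize (HN n Hn). simpl pos in HN.
    rewrite Rminus_0_r in HN. apply Rabs_def2 in HN.
    destruct (HD z Hz) as [_ HDz]. eapply Rle_lt_trans; [apply HDz|]. lra. }
  apply (CVU_derivable f d F _ c r HU).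
  - intros z Hz. apply is_lim_seq_Reals. now apply Hf.
  - intros n z Hz. apply is_derive_Reals. now apply Hd.
  - exact Hy.
Qed.

Lemma ln_Gamma_add_nat (n : nat) (x : R) : 0 < x ->
  ln (Gamma (x + INR n)) = ln (Gamma x) + sum_lt n (fun k => ln (x + INR k)).
Proof.
  intros Hx. induction n as [|n IH].
  - unfold sum_lt; simpl. rewrite !Rplus_0_r. reflexivity.
  - rewrite sum_lt_S, S_INR. assert (Hn := pos_INR n).
    replace (x + (INR n + 1)) with (x + INR n + 1) by ring.
    rewrite Gamma_succ, ln_mult, IH by (try apply Gamma_pos; lra). ring.
Qed.

Lemma ln_succ_bounds (n : nat) :
  / INR (S (S n)) <= ln (INR (S (S n))) - ln (INR (S n)) <= / INR (S n).
Proof.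
  assert (H1 : 0 < INR (S n)) by (apply lt_0_INR; lia).
  assert (E : INR (S (S n)) = INR (S n) + 1) by apply S_INR.
  assert (HL : forall a b, 0 < a -> 0 < b -> ln b - ln a <= (b - a) / a).
  { intros a b Ha Hb. rewrite <- ln_div by assumption.
    rewrite <- (ln_exp ((b - a) / a)). apply ln_le; [now apply Rdiv_lt_0_compat|].
    generalize (exp_ineq1_le ((b - a) / a)).
    replace (b / a) with (1 + (b - a) / a) by (field; lra). lra. }
  assert (A := HL (INR (S n)) (INR (S (S n))) ltac:(lra) ltac:(lra)).
  assert (B := HL (INR (S (S n))) (INR (S n)) ltac:(lra) ltac:(lra)).
  rewrite E in *. split.
  - replace ((INR (S n) - (INR (S n) + 1)) / (INR (S n) + 1)) with (- / (INR (S n) + 1)) in B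
      by (field; lra). lra.
  - replace ((INR (S n) + 1 - INR (S n)) / INR (S n)) with (/ INR (S n)) in A
      by (field; lra). lra.
Qed.

(* Euler's limit formula, in the manner of Bohr and Mollerup: the chords of the
   convex function [ln Gamma] on [n-1, n], [n, n+1] pinch its value at [n + x]. *)
Lemma ln_Gamma_lim (x : R) : 0 < x < 1 ->
  is_lim_seq (fun n => ln (Gamma (INR (S n))) + x * ln (INR (S n))
                       - sum_lt (S n) (fun k => ln (x + INR k)))
    (ln (Gamma x)).
Proof.
  intros Hx.
  apply is_lim_seq_incr_1.
  apply is_lim_seq_le_le with
    (u := fun n => ln (Gamma x)) (w := fun n => ln (Gamma x) + / INR (S n)).
  - intros n.
    set (a := INR (S n)). set (b := INR (S (S n))).
    assert (Ha : 0 < a) by (apply lt_0_INR; lia).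
    assert (Eb : b = a + 1) by apply S_INR.
    assert (E1 := ln_Gamma_add_nat (S (S n)) x (proj1 Hx)). fold b in E1.
    assert (E2 : ln (Gamma b) = ln (Gamma a) + ln a).
    { rewrite Eb, Gamma_succ, ln_mult by (try apply Gamma_pos; lra). ring. }
    assert (E3 : ln (Gamma (b + 1)) = ln (Gamma b) + ln b).
    { rewrite Gamma_succ, ln_mult by (try apply Gamma_pos; lra). ring. }
    assert (C1 := ln_Gamma_convex (1 - x) b (b + 1) ltac:(lra) ltac:(lra) ltac:(lra)).
    replace ((1 - x) * b + (1 - (1 - x)) * (b + 1)) with (x + b) in C1 by ring.
    (* [b] divides the segment from [a = b - 1] to [b + x] in the ratio [1 : x], hence the weight
       [1 / (1 + x)] on [x + b]. This yields the lower slope [ln a], while [C1] yields the upper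
       slope [ln b]; they differ by at most [1 / a]. *)
    assert (C2 := ln_Gamma_convex (/ (1 + x)) (x + b) a).
    assert (Hi : 0 < / (1 + x) < 1).
    { split; [apply Rinv_0_lt_compat; lra|].
      rewrite <- Rinv_1. apply Rinv_lt_contravar; lra. }
    specialize (C2 ltac:(lra) ltac:(lra) ltac:(lra)).
    replace (/ (1 + x) * (x + b) + (1 - / (1 + x)) * a) with b in C2
      by (rewrite Eb; field; lra).
    apply (Rmult_le_compat_l (1 + x)) in C2; [|lra].
    replace ((1 + x) * (/ (1 + x) * ln (Gamma (x + b)) + (1 - / (1 + x)) * ln (Gamma a)))
      with (ln (Gamma (x + b)) + x * ln (Gamma a)) in C2 by (field; lra).
    assert (HL := ln_succ_bounds n). fold a b in HL.
    assert (0 < / a) by now apply Rinv_0_lt_compat.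
    rewrite E3 in C1. rewrite E1 in C1, C2.
    assert (x * (ln b - ln a) <= / a) by nra.
    split; nra.
  - apply is_lim_seq_const.
  - replace (Finite (ln (Gamma x))) with (Finite (ln (Gamma x) + 0)) by (f_equal; ring).
    apply is_lim_seq_plus'; [apply is_lim_seq_const|apply inv_succ_lim].
Qed.

Lemma trigamma_series (x : R) : 0 < x < 1 ->
  is_lim_seq (fun n => sum_lt n (fun k => / (x + INR k) ^ 2)) (trigamma x).
Proof.
  intros Hx.
  assert (Hr : 0 < 1 / 2) by lra. set (r := mkposreal _ Hr).
  assert (HB : forall y, Boule (1 / 2) r y <-> 0 < y < 1).
  { intros y. unfold Boule, r; simpl. split.
    - intros H. apply Rabs_def2 in H. lra.
    - intros H. apply Rabs_def1; lra. }
  destruct (is_derive_lim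
    (fun n y => ln (Gamma (INR (S n))) + y * ln (INR (S n))
                - sum_lt (S n) (fun k => ln (y + INR k)))
    (fun n y => ln (INR (S n)) - sum_lt (S n) (fun k => / (y + INR k)))
    (fun y => ln (Gamma y)) (1 / 2) r 1) as [D HD].
  { intros n y Hy. apply HB in Hy.
    apply (is_derive_minus (V := R_NormedModule)).
    - generalize (INR (S n)). intros a. auto_derive; [trivial|ring].
    - apply (is_derive_sum_lt (S n) (fun k y => ln (y + INR k)) (fun k y => / (y + INR k))).
      intros k _. assert (Hk := pos_INR k). auto_derive; [lra|field; lra]. }
  { intros y Hy. apply HB in Hy. now apply ln_Gamma_lim. }
  (* Both [ln (n + 2) - ln (n + 1)] and the new term [1 / (y + n + 1)] lie between [1 / (n + 2)] and
     [1 / (n + 1)], so their difference is bounded by the telescoping quantity. *)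
  { intros n y Hy. apply HB in Hy. rewrite (sum_lt_S (S n)).
    assert (HL := ln_succ_bounds n).
    assert (Ha : 0 < INR (S n)) by (apply lt_0_INR; lia).
    rewrite S_INR in HL |- *.
    assert (/ (INR (S n) + 1) <= / (y + INR (S n)) <= / INR (S n)).
    { split; apply Rinv_le_contravar; lra. }
    set (s := sum_lt (S n) (fun k => / (y + INR k))) in *.
    apply Rabs_le. lra. }
  destruct (is_derive_lim
    (fun n y => ln (INR (S n)) - sum_lt (S n) (fun k => / (y + INR k)))
    (fun n y => sum_lt (S n) (fun k => / (y + INR k) ^ 2))
    D (1 / 2) r 2) as [T HT].
  { intros n y Hy. apply HB in Hy.
    replace (sum_lt (S n) (fun k => / (y + INR k) ^ 2))
      with (minus 0 (sum_lt (S n) (fun k => - / (y + INR k) ^ 2))).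
    2:{ rewrite (sum_lt_ext _ (fun k => - / (y + INR k) ^ 2)
          (fun k => (-1) * / (y + INR k) ^ 2)) by (intros; ring).
        rewrite sum_lt_scal. unfold minus, plus, opp; simpl. ring. }
    apply (is_derive_minus (V := R_NormedModule)).
    - apply (is_derive_const (V := R_NormedModule)).
    - apply (is_derive_sum_lt (S n) (fun k y => / (y + INR k)) (fun k y => - / (y + INR k) ^ 2)).
      intros k _. assert (Hk := pos_INR k). auto_derive; [lra|field; lra]. }
  { intros y Hy. exact (proj1 (HD y Hy)). }
  { intros n y Hy. apply HB in Hy. rewrite (sum_lt_S (S n)).
    assert (Ha : 1 <= INR (S n)) by (rewrite S_INR; generalize (pos_INR n); lra).
    rewrite (S_INR (S n)).
    set (a := INR (S n)) in *.
    assert (/ (y + a) ^ 2 <= / a ^ 2) by (apply Rinv_le_contravar; nra).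
    assert (0 < / (y + a) ^ 2) by (apply Rinv_0_lt_compat; nra).
    assert (/ a ^ 2 <= 2 * (/ a - / (a + 1))).
    { replace (2 * (/ a - / (a + 1))) with (/ (a * (a + 1) / 2)) by (field; lra).
      apply Rinv_le_contravar; nra. }
    apply Rabs_le. lra. }
  (* So far only [ln Gamma] is known to be differentiable; writing [Gamma = exp (ln Gamma)] near [y]
     makes [Derive Gamma] a genuine derivative. *)
  assert (Hdig : forall y, 0 < y < 1 -> digamma y = D y).
  { intros y Hy. apply HB in Hy. destruct (HD y Hy) as [_ HDy]. apply HB in Hy.
    assert (HG := Gamma_pos y (proj1 Hy)).
    unfold digamma.
    assert (is_derive Gamma y (scal (D y) (Gamma y))) as ->%is_derive_unique.
    { apply is_derive_ext_loc with (fun z => exp (ln (Gamma z))).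
      - apply (locally_open_interval 0 1); [assumption|]. intros z Hz.
        apply exp_ln, Gamma_pos. lra.
      - apply (is_derive_comp exp (fun z => ln (Gamma z))); [|exact HDy].
        rewrite <- (exp_ln (Gamma y)) at 2 by assumption. apply is_derive_exp. }
    unfold scal; simpl; unfold mult; simpl. field. lra. }
  assert (HTx := Hx). apply HB in HTx. destruct (HT x HTx) as [H1 H2].
  assert (trigamma x = T x) as ->.
  { apply is_derive_unique. apply is_derive_ext_loc with D; [|exact H2].
    apply (locally_open_interval 0 1); [assumption|]. intros z Hz. symmetry. now apply Hdig. }
  apply is_lim_seq_incr_1. exact H1.
Qed.

(** * Factorization of 1 + y^m *)

(* [poly_lead a n f]: [f] is a polynomial function of formal degree [n] with
   leading coefficient [a] (possibly 0), in Horner form. *)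
Fixpoint poly_lead (a : R) (n : nat) (f : R -> R) : Prop :=
  match n with
  | O => forall x, f x = a
  | S n => exists g c, poly_lead a n g /\ forall x, f x = x * g x + c
  end.

Lemma poly_lead_0_S (a : R) (n : nat) (f : R -> R) : poly_lead a n f -> poly_lead 0 (S n) f.
Proof.
  revert f. induction n as [|n IH]; intros f; simpl.
  - intros H. exists (fun _ => 0), a. split; [reflexivity|]. intros x. rewrite H. ring.
  - intros (g & c & Hg & Hf). exists g, c. split; [|exact Hf]. exact (IH g Hg).
Qed.

Lemma poly_lead_lin (a b r : R) (n : nat) (f g : R -> R) :
  poly_lead a n f -> poly_lead b n g -> poly_lead (a + r * b) n (fun x => f x + r * g x).
Proof.
  revert f g. induction n as [|n IH]; intros f g; simpl.
  - intros Hf Hg x. now rewrite Hf, Hg.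
  - intros (f' & c & Hf' & Hf) (g' & d & Hg' & Hg).
    exists (fun x => f' x + r * g' x), (c + r * d). split; [now apply IH|].
    intros x. rewrite Hf, Hg. ring.
Qed.

Lemma poly_lead_ext (a : R) (n : nat) (f g : R -> R) :
  (forall x, f x = g x) -> poly_lead a n f -> poly_lead a n g.
Proof.
  intros E. destruct n as [|n]; simpl.
  - intros H x. now rewrite <- E.
  - intros (h & c & Hh & Hf). exists h, c. split; [exact Hh|]. intros x. now rewrite <- E.
Qed.

(** Synthetic division: if [h] is the quotient of [g], then that of [x g + c] is [g + r h]. Since
    [h] has lower degree, it is lifted with leading coefficient 0 and [a] is preserved. *)
Lemma poly_lead_div (a r : R) (n : nat) (f : R -> R) : poly_lead a (S n) f ->
  exists q, poly_lead a n q /\ forall x, f x - f r = (x - r) * q x.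
Proof.
  revert f. induction n as [|n IH]; intros f (g & c & Hg & Hf).
  - exists g. split; [exact Hg|]. intros x. simpl in Hg. rewrite !Hf, !Hg. ring.
  - destruct (IH g Hg) as (h & Hh & E). apply poly_lead_0_S in Hh.
    exists (fun x => g x + r * h x). split.
    + replace a with (a + r * 0) by ring. now apply poly_lead_lin.
    + intros x. rewrite !Hf.
      replace (x * g x + c - (r * g r + c)) with ((x - r) * g x + r * (g x - g r)) by ring.
      rewrite E. ring.
Qed.

Fixpoint prod_lt (n : nat) (f : nat -> R) : R :=
  match n with O => 1 | S n => prod_lt n f * f n end.

Lemma poly_lead_factor (a : R) (n : nat) (f : R -> R) (r : nat -> R) :
  poly_lead a n f ->
  (forall k, (k < n)%nat -> f (r k) = 0) ->
  (forall j k, (j < k < n)%nat -> r j <> r k) ->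
  forall x, f x = a * prod_lt n (fun k => x - r k).
Proof.
  revert f. induction n as [|n IH]; intros f Hp H0 Hr x.
  - simpl in *. rewrite Hp. ring.
  - destruct (poly_lead_div a (r n) n f Hp) as (q & Hq & E).
    rewrite (H0 n) in E by lia.
    assert (Eq := IH q Hq). simpl. rewrite <- Rmult_assoc, <- Eq.
    + generalize (E x). lra.
    + intros k Hk. generalize (E (r k)). rewrite H0 by lia. intros E'.
      assert (Hne : r k <> r n) by (apply Hr; lia).
      assert (E2 : (r k - r n) * q (r k) = 0) by lra.
      apply Rmult_integral in E2. destruct E2; [lra|assumption].
    + intros j k Hjk. apply Hr. lia.
Qed.

(** Two consecutive values are carried together to make the second-order recurrence structural. *)
Fixpoint cheb_pair (b c : R) (n : nat) (w : R) : R * R :=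
  match n with
  | O => (b, w + c)
  | S n => let p := cheb_pair b c n w in (snd p, w * snd p - fst p)
  end.

(* With [w = y + 1/y], the choice [b = 2], [c = 0] gives [y^n + 1/y^n] and
   [b = 1], [c = -1] gives [(y^(2n+1) + 1) / (y^n (y + 1))]. *)
Definition cheb (b c : R) (n : nat) (w : R) : R := fst (cheb_pair b c n w).

Lemma cheb_SS (b c : R) (n : nat) (w : R) :
  cheb b c (S (S n)) w = w * cheb b c (S n) w - cheb b c n w.
Proof. reflexivity. Qed.

(** One recurrence has two families of solutions: powers of [y] at [w = y + 1/y], which give the
    expression to factor, and cosines at [w = 2 cos t], which give the roots. The scale [l] absorbs
    the factors [y + 1] and [cos (t / 2)] of the odd case. *)
Lemma cheb_unique (b c w l : R) (s : nat -> R) :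
  s O = b * l -> s 1%nat = (w + c) * l ->
  (forall n, s (S (S n)) = w * s (S n) - s n) ->
  forall n, s n = cheb b c n w * l.
Proof.
  intros H0 H1 H n.
  enough (s n = cheb b c n w * l /\ s (S n) = cheb b c (S n) w * l) by tauto.
  induction n as [|n [IH1 IH2]].
  - split; assumption.
  - split; [assumption|]. rewrite H, IH1, IH2, cheb_SS. ring.
Qed.

Lemma cheb_poly_lead (b c : R) (n : nat) : poly_lead 1 (S n) (cheb b c (S n)).
Proof.
  (* The lower polynomial is only required to have formal degree [n]: at [n = 0] it is the constant
     [b], which need not be 1. *)
  enough (poly_lead 1 (S n) (cheb b c (S n)) /\ exists a, poly_lead a n (cheb b c n)) by tauto.
  induction n as [|n [IH1 [a IH2]]].
  - split.
    + exists (fun _ => 1), c. split; [intros x; reflexivity|].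
      intros x. unfold cheb; simpl. ring.
    + exists b. intros x. reflexivity.
  - split; [|now exists 1].
    apply poly_lead_ext with (fun x => x * cheb b c (S n) x + (-1) * cheb b c n x).
    { intros x. rewrite cheb_SS. ring. }
    replace 1 with (1 + (-1) * 0) by ring. apply poly_lead_lin.
    + exists (cheb b c (S n)), 0. split; [exact IH1|]. intros x. ring.
    + now apply (poly_lead_0_S 0), (poly_lead_0_S a).
Qed.

Lemma cos_odd_PI2 (k : nat) : cos ((2 * INR k + 1) * (PI / 2)) = 0.
Proof.
  apply cos_eq_0_1. exists (Z.of_nat k). rewrite <- INR_IZR_INZ. field.
Qed.

Lemma odd_angle_bounds (m k : nat) : (2 * k + 1 < m)%nat ->
  0 < (2 * INR k + 1) * PI / INR m < PI.
Proof.
  intros H. assert (HP := PI_RGT_0).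
  assert (Hm : 2 * INR k + 1 < INR m).
  { replace (2 * INR k + 1) with (INR (2 * k + 1)); [now apply lt_INR|].
    rewrite plus_INR, mult_INR. simpl. ring. }
  assert (Hk := pos_INR k). split.
  - apply Rdiv_lt_0_compat; [apply Rmult_lt_0_compat|]; lra.
  - apply Rmult_lt_reg_r with (INR m); [lra|]. unfold Rdiv.
    rewrite Rmult_assoc, Rinv_l, Rmult_1_r by lra.
    rewrite (Rmult_comm PI). apply Rmult_lt_compat_r; lra.
Qed.

Lemma phi_distinct (m j k : nat) : (j < k)%nat -> (2 * k + 1 < m)%nat ->
  2 * phi m j <> 2 * phi m k.
Proof.
  intros Hjk Hk E.
  assert (Bj := odd_angle_bounds m j ltac:(lia)). assert (Bk := odd_angle_bounds m k Hk).
  assert (phi m k < phi m j); [|lra].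
  unfold phi. apply cos_decreasing_1; try lra.
  unfold Rdiv. apply Rmult_lt_compat_r.
  - apply Rinv_0_lt_compat, lt_0_INR. lia.
  - apply Rmult_lt_compat_r; [apply PI_RGT_0|]. apply lt_INR in Hjk. lra.
Qed.

Lemma cos_rec (x t : R) : cos (x + t + t) = 2 * cos t * cos (x + t) - cos x.
Proof.
  rewrite !cos_plus, !sin_plus.
  transitivity (2 * cos t * (cos x * cos t - sin x * sin t)
                - cos x * (Rsqr (sin t) + Rsqr (cos t))); [unfold Rsqr; ring|].
  rewrite sin2_cos2. ring.
Qed.

(** At [w = 2 cos t] the polynomial takes the value [2 cos (K t)], which vanishes at the odd
    multiples of [PI / (2K)]. *)
Lemma pow_add_inv_factor (K : nat) (y : R) : 0 < y -> (1 <= K)%nat ->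
  y ^ K + / y ^ K = prod_lt K (fun k => y + / y - 2 * phi (2 * K) k).
Proof.
  intros Hy HK. destruct K as [|K]; [lia|].
  rewrite (cheb_unique 2 0 (y + / y) 1 (fun n => y ^ n + / y ^ n)).
  - rewrite Rmult_1_r, (poly_lead_factor 1 (S K) _ (fun k => 2 * phi (2 * S K) k)
             (cheb_poly_lead 2 0 K)); [ring| |].
    + intros k Hk.
      set (t := (2 * INR k + 1) * PI / INR (2 * S K)).
      assert (H := cheb_unique 2 0 (2 * cos t) 1 (fun n => 2 * cos (INR n * t))).
      rewrite <- (Rmult_1_r (cheb _ _ _ _)). unfold phi. fold t. rewrite <- H.
      * replace (INR (S K) * t) with ((2 * INR k + 1) * (PI / 2)).
        { rewrite cos_odd_PI2. ring. }
        unfold t. rewrite mult_INR. change (INR 2) with 2. field.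
        apply not_0_INR. lia.
      * simpl INR. rewrite Rmult_0_l, cos_0. ring.
      * simpl INR. rewrite Rmult_1_l. ring.
      * intros n. rewrite !S_INR.
        replace ((INR n + 1 + 1) * t) with (INR n * t + t + t) by ring.
        replace ((INR n + 1) * t) with (INR n * t + t) by ring.
        rewrite cos_rec. ring.
    + intros j k Hjk. apply phi_distinct; lia.
  - simpl. field.
  - simpl. field. lra.
  - intros n. simpl. field. split; [apply pow_nonzero|]; lra.
Qed.

(** At [w = 2 cos t] the polynomial times [cos (t / 2)] is [cos ((K + 1/2) t)]; the odd multiples of
    [PI / (2K + 1)] below [PI] annihilate it while [cos (t / 2)] stays positive. *)
Lemma odd_pow_add_factor (K : nat) (y : R) : 0 < y ->
  y ^ (S K) + / y ^ K = prod_lt K (fun k => y + / y - 2 * phi (2 * K + 1) k) * (y + 1).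
Proof.
  intros Hy.
  rewrite (cheb_unique 1 (-1) (y + / y) (y + 1) (fun n => y ^ (S n) + / y ^ n)).
  - destruct K as [|K]; [unfold cheb; simpl; ring|]. f_equal.
    rewrite (poly_lead_factor 1 (S K) _ (fun k => 2 * phi (2 * S K + 1) k)
             (cheb_poly_lead 1 (-1) K)); [ring| |].
    + intros k Hk.
      set (t := (2 * INR k + 1) * PI / INR (2 * S K + 1)).
      assert (Bt := odd_angle_bounds (2 * S K + 1) k ltac:(lia)). fold t in Bt.
      assert (Hc : 0 < cos (t / 2)) by (apply cos_gt_0; lra).
      assert (Et : cos t = 2 * cos (t / 2) * cos (t / 2) - 1).
      { rewrite <- cos_2a_cos. f_equal. field. }
      assert (H := cheb_unique 1 (-1) (2 * cos t) (cos (t / 2)) (fun n => cos (INR n * t + t / 2))).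
      apply Rmult_eq_reg_r with (cos (t / 2)); [|lra]. unfold phi. fold t. rewrite <- H.
      * replace (INR (S K) * t + t / 2) with ((2 * INR k + 1) * (PI / 2)).
        { rewrite cos_odd_PI2. ring. }
        unfold t. rewrite plus_INR, mult_INR. change (INR 2) with 2. change (INR 1) with 1. field.
        generalize (pos_INR (S K)); lra.
      * simpl INR. rewrite Rmult_0_l, Rplus_0_l. ring.
      * simpl INR. rewrite Rmult_1_l.
        replace (t + t / 2) with (- (t / 2) + t + t) by field.
        rewrite cos_rec, cos_neg. replace (- (t / 2) + t) with (t / 2) by field. ring.
      * intros n. rewrite !S_INR.
        replace ((INR n + 1 + 1) * t + t / 2) with (INR n * t + t / 2 + t + t) by ring.
        replace ((INR n + 1) * t + t / 2) with (INR n * t + t / 2 + t) by ring.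
        rewrite cos_rec. ring.
    + intros j k Hjk. apply phi_distinct; lia.
  - simpl. field.
  - simpl. field. lra.
  - intros n. simpl. field. split; [apply pow_nonzero|]; lra.
Qed.

Lemma quadratic_cos_pos (b x : R) : 0 < sin b -> 0 < x ^ 2 - 2 * cos b * x + 1.
Proof.
  intros Hs. replace (x ^ 2 - 2 * cos b * x + 1) with (Rsqr (x - cos b) + Rsqr (sin b)).
  - apply Rplus_le_lt_0_compat; [apply Rle_0_sqr|apply Rsqr_pos_lt; lra].
  - rewrite <- (sin2_cos2 b). unfold Rsqr. ring.
Qed.

Lemma ln_prod_lt (n : nat) (f : nat -> R) :
  (forall k, (k < n)%nat -> 0 < f k) ->
  0 < prod_lt n f /\ ln (prod_lt n f) = sum_lt n (fun k => ln (f k)).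
Proof.
  induction n as [|n IH]; intros H.
  - simpl. split; [lra|]. apply ln_1.
  - destruct IH as [H1 H2]; [intros; apply H; lia|].
    assert (H3 := H n ltac:(lia)). simpl. rewrite sum_lt_S.
    split; [now apply Rmult_lt_0_compat|]. now rewrite ln_mult, H2.
Qed.

Lemma prod_lt_scal (n : nat) (a : R) (f : nat -> R) :
  a ^ n * prod_lt n f = prod_lt n (fun k => a * f k).
Proof. induction n as [|n IH]; simpl; [ring|]. rewrite <- IH. ring. Qed.

Lemma prod_lt_ext (n : nat) (f g : nat -> R) :
  (forall k, f k = g k) -> prod_lt n f = prod_lt n g.
Proof. intros H. induction n as [|n IH]; simpl; [reflexivity|]. now rewrite IH, H. Qed.

Lemma ln_prod_quadratic (m K : nat) (y : R) : 0 < y -> (2 * K <= m)%nat ->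
  let P := y ^ K * prod_lt K (fun k => y + / y - 2 * phi m k) in
  0 < P /\ ln P = sum_lt K (fun k => ln (y ^ 2 - 2 * phi m k * y + 1)).
Proof.
  intros Hy HK. rewrite prod_lt_scal.
  rewrite (prod_lt_ext K _ (fun k => y ^ 2 - 2 * phi m k * y + 1)) by (intros; field; lra).
  apply ln_prod_lt. intros k Hk. unfold phi.
  destruct (odd_angle_bounds m k ltac:(lia)). now apply quadratic_cos_pos, sin_gt_0.
Qed.

Lemma ln_pow_even_add_1 (K : nat) (y : R) : 0 < y -> (1 <= K)%nat ->
  ln (y ^ (2 * K) + 1) = sum_lt K (fun k => ln (y ^ 2 - 2 * phi (2 * K) k * y + 1)).
Proof.
  intros Hy HK. destruct (ln_prod_quadratic (2 * K) K y Hy (le_n _)) as [_ <-].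
  f_equal. rewrite <- pow_add_inv_factor by assumption.
  replace (2 * K)%nat with (K + K)%nat by lia. rewrite pow_add. field.
  apply pow_nonzero; lra.
Qed.

Lemma ln_pow_odd_add_1 (K : nat) (y : R) : 0 < y ->
  ln (y ^ (2 * K + 1) + 1) =
  sum_lt K (fun k => ln (y ^ 2 - 2 * phi (2 * K + 1) k * y + 1)) + ln (y + 1).
Proof.
  intros Hy. destruct (ln_prod_quadratic (2 * K + 1) K y Hy ltac:(lia)) as [HP <-].
  rewrite <- ln_mult by lra. f_equal.
  rewrite Rmult_assoc, <- odd_pow_add_factor by assumption.
  replace (2 * K + 1)%nat with (K + S K)%nat by lia. rewrite pow_add. field.
  apply pow_nonzero; lra.
Qed.

(** * Fourier series of log (2 cos s) *)

(** Both [h + f] and [h - f] have nonnegative derivatives, so the mean value theorem applies. This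
    replaces estimates of integrals, with no integrability to check. *)
Lemma derive_dominated (f df h dh : R -> R) (a b : R) : a <= b ->
  (forall x, a <= x <= b -> is_derive f x (df x)) ->
  (forall x, a <= x <= b -> is_derive h x (dh x)) ->
  (forall x, a <= x <= b -> Rabs (df x) <= dh x) ->
  Rabs (f b - f a) <= h b - h a.
Proof.
  intros Hab Hf Hh Hd.
  assert (HM : forall e, e = 1 \/ e = -1 -> 0 <= (h b + e * f b) - (h a + e * f a)).
  { intros e He.
    assert (HD : forall x, a <= x <= b -> is_derive (fun x => h x + e * f x) x (dh x + e * df x)).
    { intros x Hx. apply (is_derive_plus (V := R_NormedModule) h (fun x => e * f x)); [now apply Hh|].
      now apply is_derive_scal, Hf. }
    destruct (MVT_gen (fun x => h x + e * f x) a b (fun x => dh x + e * df x)) as (c & Hc & E);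
      rewrite ?Rmin_left, ?Rmax_right in * by lra.
    - intros x Hx. apply (HD x); lra.
    - intros x Hx. apply derivable_continuous_pt. exists (dh x + e * df x).
      apply is_derive_Reals. exact (HD x Hx).
    - rewrite E. apply Rmult_le_pos; [|lra]. specialize (Hd c Hc). apply Rabs_le_between in Hd.
      destruct He as [-> | ->]; lra. }
  generalize (HM 1 (or_introl eq_refl)) (HM (-1) (or_intror eq_refl)). intros.
  apply Rabs_le. lra.
Qed.

(** By the finite geometric sum, the remainder of the series of [ln (1 + x)] has derivative
    [(-x)^N / (1 + x)], dominated by [x^N] on [[0, 1]]. *)
Lemma alt_harmonic_bound (N : nat) :
  Rabs (ln 2 - sum_lt N (fun k => (-1) ^ k / INR (S k))) <= / INR (S N).
Proof.
  assert (Hpos : forall k, 0 < INR (S k)) by (intros; apply lt_0_INR; lia).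
  set (f := fun x => ln (1 + x) - sum_lt N (fun k => (-1) ^ k / INR (S k) * x ^ S k)).
  assert (H := derive_dominated f (fun x => (-x) ^ N / (1 + x))
                 (fun x => / INR (S N) * x ^ S N) (fun x => x ^ N) 0 1 ltac:(lra)).
  replace (ln 2 - sum_lt N (fun k => (-1) ^ k / INR (S k))) with (f 1 - f 0).
  - replace (/ INR (S N)) with (/ INR (S N) * 1 ^ S N - / INR (S N) * 0 ^ S N)
      by (rewrite pow1, pow_i by lia; ring).
    apply H.
    + intros x Hx. unfold f.
      assert (G : (-x) ^ N / (1 + x) = / (1 + x) - sum_lt N (fun k => (-x) ^ k)).
      { clear - Hx. induction N as [|N IH]; [unfold sum_lt; simpl; field; lra|].
        rewrite sum_lt_S. simpl pow.
        replace (- x * (- x) ^ N / (1 + x)) with ((- x) ^ N / (1 + x) - (- x) ^ N) by (field; lra).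
        rewrite IH. ring. }
      rewrite G. apply (is_derive_minus (V := R_NormedModule)).
      * auto_derive; [lra|field; lra].
      * apply (is_derive_sum_lt N (fun k x => (-1) ^ k / INR (S k) * x ^ S k) (fun k x => (- x) ^ k)).
        intros k _. specialize (Hpos k).
        replace ((- x) ^ k) with ((-1) ^ k / INR (S k) * (INR (S k) * x ^ k)).
        2:{ replace (- x) with ((-1) * x) by ring. rewrite Rpow_mult_distr. field. lra. }
        apply is_derive_scal.
        assert (D := is_derive_pow (fun y => y) (S k) x 1 (is_derive_id x)).
        rewrite Rmult_1_r in D. exact D.
    + intros x Hx. specialize (Hpos N).
      replace (x ^ N) with (/ INR (S N) * (INR (S N) * x ^ N)) by (field; lra).
      apply is_derive_scal.
      assert (D := is_derive_pow (fun y => y) (S N) x 1 (is_derive_id x)).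
      rewrite Rmult_1_r in D. exact D.
    + intros x Hx. unfold Rdiv. rewrite Rabs_mult, <- RPow_abs, Rabs_Ropp, (Rabs_pos_eq x) by lra.
      assert (0 < / (1 + x) <= 1).
      { split; [apply Rinv_0_lt_compat; lra|]. rewrite <- Rinv_1. apply Rinv_le_contravar; lra. }
      rewrite Rabs_pos_eq by lra. assert (0 <= x ^ N) by (apply pow_le; lra). nra.
  - unfold f. rewrite Rplus_0_r, ln_1. replace (1 + 1) with 2 by ring.
    rewrite (sum_lt_ext N (fun k => (-1) ^ k / INR (S k) * 1 ^ S k) (fun k => (-1) ^ k / INR (S k)))
      by (intros; rewrite pow1; ring).
    rewrite (sum_lt_ext N (fun k => (-1) ^ k / INR (S k) * 0 ^ S k) (fun k => 0 * 0))
      by (intros; rewrite pow_i by lia; ring).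
    rewrite sum_lt_scal. ring.
Qed.

Lemma cos_ge_half (s : R) : 0 <= s <= PI / 3 -> 1 / 2 <= cos s.
Proof.
  intros Hs. rewrite <- cos_PI3. assert (HP := PI_RGT_0). apply cos_decr_1; lra.
Qed.

(** An alternating Dirichlet kernel: [2 cos s sin x = sin (x + s) + sin (x - s)] makes the sum
    telescope. *)
Lemma alt_sin_kernel (N : nat) (d s : R) :
  cos s * sum_lt N (fun k => 2 * (-1) ^ k * sin (2 * INR (S k) * s + d)) =
  sin (s + d) - (-1) ^ N * sin ((2 * INR N + 1) * s + d).
Proof.
  induction N as [|N IH].
  - unfold sum_lt. simpl. replace ((2 * 0 + 1) * s + d) with (s + d) by ring. ring.
  - rewrite sum_lt_S, Rmult_plus_distr_l, IH. rewrite S_INR. simpl pow.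
    replace ((2 * (INR N + 1) + 1) * s + d) with (2 * (INR N + 1) * s + d + s) by ring.
    replace ((2 * INR N + 1) * s + d) with (2 * (INR N + 1) * s + d - s) by ring.
    set (x := 2 * (INR N + 1) * s + d).
    rewrite (sin_plus x), (sin_minus x). ring.
Qed.

(** Partial sums of the real part of [exp(i d) log(1 + exp(2 i s))], which is
    [cos d ln (2 cos s) - s sin d]. The phase lets one argument cover the logarithm ([d = 0]) and
    the linear function [- s] ([d = PI/2]). *)
Definition alt_fourier (d : R) (N : nat) (s : R) : R :=
  sum_lt N (fun k => (-1) ^ k * cos (2 * INR (S k) * s + d) / INR (S k)).

(* Integrating the kernel by parts gains the factor 1 / (2N+1). *)
Lemma alt_fourier_oscillation (d : R) (L : R -> R) (N : nat) (s : R) :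
  (forall u, 0 <= u <= PI / 3 -> is_derive L u (- sin (u + d) / cos u)) ->
  0 <= s <= PI / 3 ->
  Rabs ((L s - alt_fourier d N s) - (L 0 - alt_fourier d N 0)) <= 11 / (2 * INR N + 1).
Proof.
  intros HL Hs. set (M := 2 * INR N + 1).
  assert (HM : 0 < M) by (unfold M; generalize (pos_INR N); lra).
  assert (HMi : 0 < / M) by now apply Rinv_0_lt_compat.
  set (R0 := fun s => L s - alt_fourier d N s).
  set (e := (-1) ^ N).
  assert (He : Rabs e = 1) by (unfold e; apply pow_1_abs).
  (* The kernel identity makes the derivative of [R0] equal to [- e sin (M s + d) / cos s]. [B] is
     the boundary term of its integration by parts; since [cos >= 1/2], the remaining derivative is
     at most [4 / M]. *)
  set (B := fun s => e * cos (M * s + d) / (M * cos s)).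
  assert (HB : forall u, 0 <= u <= PI / 3 -> Rabs (B u) <= 2 / M).
  { intros u Hu. apply cos_ge_half in Hu. unfold B, Rdiv.
    rewrite !Rabs_mult, He, (Rabs_pos_eq (/ _)) by (left; apply Rinv_0_lt_compat, Rmult_lt_0_compat; lra).
    assert (Rabs (cos (M * u + d)) <= 1) by (apply Rabs_le, COS_bound).
    assert (/ (M * cos u) <= 2 * / M).
    { replace (2 * / M) with (/ (M * (1 / 2))) by (field; lra).
      apply Rinv_le_contravar; nra. }
    assert (0 < / (M * cos u)) by (apply Rinv_0_lt_compat; nra).
    assert (Hcp := Rabs_pos (cos (M * u + d))). nra. }
  set (Q := fun s => R0 s - B s).
  assert (HQ : Rabs (Q s - Q 0) <= 4 / M * s - 4 / M * 0).
  { apply (derive_dominated Q (fun u => - (e * cos (M * u + d) * sin u / (M * (cos u) ^ 2)))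
             (fun x => 4 / M * x) (fun _ => 4 / M)); [lra| | |].
    - intros u Hu. assert (Hu' : 0 <= u <= PI / 3) by lra. assert (Hc := cos_ge_half u Hu').
      assert (K := alt_sin_kernel N d u). fold M e in K.
      replace (- (e * cos (M * u + d) * sin u / (M * (cos u) ^ 2)))
        with ((- sin (u + d) / cos u - - sum_lt N (fun k => 2 * (-1) ^ k * sin (2 * INR (S k) * u + d)))
               - (- e * sin (M * u + d) / cos u + e * cos (M * u + d) * sin u / (M * (cos u) ^ 2))).
      2:{ apply (f_equal (fun z => z / cos u)) in K. unfold Rdiv in K at 1.
          rewrite Rmult_comm, <- Rmult_assoc, Rinv_l, Rmult_1_l in K by lra.
          rewrite K. field. split; lra. }
      apply (is_derive_minus (V := R_NormedModule)).
      + apply (is_derive_minus (V := R_NormedModule)); [now apply HL|].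
        replace (- sum_lt N (fun k => 2 * (-1) ^ k * sin (2 * INR (S k) * u + d)))
          with (sum_lt N (fun k => - (2 * (-1) ^ k * sin (2 * INR (S k) * u + d)))).
        2:{ rewrite (sum_lt_ext N _ (fun k => (-1) * (2 * (-1) ^ k * sin (2 * INR (S k) * u + d))))
              by (intros; ring). rewrite sum_lt_scal. ring. }
        apply (is_derive_sum_lt N (fun k s => (-1) ^ k * cos (2 * INR (S k) * s + d) / INR (S k))
                 (fun k u => - (2 * (-1) ^ k * sin (2 * INR (S k) * u + d)))).
        intros k _. assert (0 < INR (S k)) by (apply lt_0_INR; lia).
        generalize ((-1) ^ k). revert H. generalize (INR (S k)). intros a Ha c.
        auto_derive; [trivial|]. field. lra.
      + unfold B. auto_derive; [nra|]. field. split; lra.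
    - intros u _. auto_derive; [trivial|ring].
    - intros u Hu. assert (Hu' : 0 <= u <= PI / 3) by lra. assert (Hc := cos_ge_half u Hu').
      assert (HMc : 0 < M * cos u ^ 2) by (apply Rmult_lt_0_compat; [|apply pow_lt]; lra).
      assert (Hc4 : 1 / 4 <= cos u ^ 2) by nra.
      assert (H0 : 0 < / (M * cos u ^ 2)) by now apply Rinv_0_lt_compat.
      unfold Rdiv. rewrite Rabs_Ropp, !Rabs_mult, He.
      rewrite (Rabs_pos_eq (/ _)) by lra.
      assert (Rabs (cos (M * u + d)) <= 1) by (apply Rabs_le, COS_bound).
      assert (Rabs (sin u) <= 1) by (apply Rabs_le, SIN_bound).
      assert (Rabs (cos (M * u + d)) * Rabs (sin u) <= 1 * 1)
        by (apply Rmult_le_compat; try assumption; apply Rabs_pos).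
      assert (/ (M * cos u ^ 2) <= 4 * / M).
      { replace (4 * / M) with (/ (M * (1 / 4))) by (field; lra).
        apply Rinv_le_contravar; [lra|]. apply Rmult_le_compat_l; lra. }
      nra. }
  assert (HP := PI_4).
  assert (HB0 : Rabs (B 0) <= 1 / M).
  { unfold B. rewrite cos_0. unfold Rdiv. rewrite !Rabs_mult, He, Rmult_1_r.
    rewrite (Rabs_pos_eq (/ M)) by lra.
    assert (Rabs (cos (M * 0 + d)) <= 1) by (apply Rabs_le, COS_bound).
    nra. }
  specialize (HB s Hs).
  assert (Hs2 : 4 / M * s <= 8 / M) by (unfold Rdiv; nra).
  change (Rabs (R0 s - R0 0) <= 11 / M).
  replace (R0 s - R0 0) with ((Q s - Q 0) + (B s - B 0)) by (unfold Q; ring).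
  (* The three parts bound the growth of [Q], using [s <= 2], and the values of [B] at [s] and at
     0. *)
  replace (11 / M) with (8 / M + (2 / M + 1 / M)) by (field; lra).
  eapply Rle_trans; [apply Rabs_triang|]. apply Rplus_le_compat.
  { eapply Rle_trans; [exact HQ|]. rewrite Rmult_0_r, Rminus_0_r. exact Hs2. }
  unfold Rminus. eapply Rle_trans; [apply Rabs_triang|]. rewrite Rabs_Ropp. lra.
Qed.

(** At [s = 0] the series is [cos d] times the alternating harmonic series, which fixes the initial
    value of [L]; its error raises the 11 to 12. *)
Lemma alt_fourier_uniform (d : R) (L : R -> R) (N : nat) (s : R) :
  (forall u, 0 <= u <= PI / 3 -> is_derive L u (- sin (u + d) / cos u)) ->
  L 0 = cos d * ln 2 -> 0 <= s <= PI / 3 ->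
  Rabs (L s - alt_fourier d N s) <= 12 / INR (S N).
Proof.
  intros HL HL0 Hs. assert (H := alt_fourier_oscillation d L N s HL Hs).
  assert (E : alt_fourier d N 0 = cos d * sum_lt N (fun k => (-1) ^ k / INR (S k))).
  { unfold alt_fourier. rewrite <- sum_lt_scal. apply sum_lt_ext. intros k _.
    rewrite Rmult_0_r, Rplus_0_l. unfold Rdiv. ring. }
  rewrite E, HL0, <- Rmult_minus_distr_l in H.
  assert (HA := alt_harmonic_bound N).
  set (z := ln 2 - sum_lt N (fun k => (-1) ^ k / INR (S k))) in *.
  assert (Rabs (cos d * z) <= / INR (S N)).
  { rewrite Rabs_mult. assert (Rabs (cos d) <= 1) by (apply Rabs_le, COS_bound).
    generalize (Rabs_pos z) (Rabs_pos (cos d)). intros. nra. }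
  assert (Hn := pos_INR N).
  assert (11 / (2 * INR N + 1) <= 11 / INR (S N)).
  { unfold Rdiv. apply Rmult_le_compat_l; [lra|].  rewrite S_INR. apply Rinv_le_contravar; lra. }
  replace (12 / INR (S N)) with (11 / INR (S N) + / INR (S N)) by (rewrite S_INR; field; lra).
  replace (L s - alt_fourier d N s) with ((L s - alt_fourier d N s - cos d * z) + cos d * z) by ring.
  eapply Rle_trans; [apply Rabs_triang|]. lra.
Qed.

(** The error [12 / (N + 1)] is uniform, so after integration over [[0, s]] it is at most
    [12 s / (N + 1)]. *)
Lemma alt_fourier_integrated (d : R) (L M : R -> R) (s : R) :
  (forall u, 0 <= u <= PI / 3 -> is_derive L u (- sin (u + d) / cos u)) ->
  L 0 = cos d * ln 2 ->
  (forall u, 0 <= u <= PI / 3 -> is_derive M u (L u)) ->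
  0 <= s <= PI / 3 ->
  is_lim_seq (fun N => sum_lt N (fun k =>
      (-1) ^ k * (sin (2 * INR (S k) * s + d) - sin d) / (2 * INR (S k) ^ 2))) (M s - M 0).
Proof.
  intros HL HL0 HM Hs.
  set (S1 := fun N s => sum_lt N (fun k =>
      (-1) ^ k * (sin (2 * INR (S k) * s + d) - sin d) / (2 * INR (S k) ^ 2))).
  assert (H : forall N, Rabs ((M s - S1 N s) - (M 0 - S1 N 0)) <= 12 / INR (S N) * s - 12 / INR (S N) * 0).
  { intros N.
    apply (derive_dominated (fun s => M s - S1 N s) (fun u => L u - alt_fourier d N u)
             (fun x => 12 / INR (S N) * x) (fun _ => 12 / INR (S N))); [lra| | |].
    - intros u Hu. apply (is_derive_minus (V := R_NormedModule)); [apply HM; lra|].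
      apply (is_derive_sum_lt N (fun k s => (-1) ^ k * (sin (2 * INR (S k) * s + d) - sin d) / (2 * INR (S k) ^ 2))
               (fun k u => (-1) ^ k * cos (2 * INR (S k) * u + d) / INR (S k))).
      intros k _. assert (0 < INR (S k)) by (apply lt_0_INR; lia).
      generalize ((-1) ^ k). revert H. generalize (INR (S k)). intros a Ha c.
      auto_derive; [trivial|]. field. lra.
    - intros u _. generalize (12 / INR (S N)). intros a. auto_derive; [trivial|ring].
    - intros u Hu. apply alt_fourier_uniform; [assumption|assumption|lra]. }
  assert (E : forall N, S1 N 0 = 0).
  { intros N. unfold S1.
    rewrite (sum_lt_ext N _ (fun k => 0 * 0)).
    - rewrite sum_lt_scal. ring.
    - intros k _. rewrite Rmult_0_r, Rplus_0_l. unfold Rdiv. ring. }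
  assert (Hl : is_lim_seq (fun N => 12 * s * / INR (S N)) 0).
  { replace (Finite 0) with (Rbar_mult (12 * s) 0) by (simpl; f_equal; ring).
    apply (is_lim_seq_scal_l _ (12 * s) 0), inv_succ_lim. }
  apply is_lim_seq_le_le with (u := fun N => (M s - M 0) - 12 * s * / INR (S N))
    (w := fun N => (M s - M 0) + 12 * s * / INR (S N)).
  - intros N. specialize (H N). rewrite E in H. apply Rabs_le_between in H.
    fold (S1 N s). unfold Rdiv in H. lra.
  - replace (Finite (M s - M 0)) with (Finite (M s - M 0 - 0)) by (f_equal; ring).
    apply is_lim_seq_minus'; [apply is_lim_seq_const|assumption].
  - replace (Finite (M s - M 0)) with (Finite (M s - M 0 + 0)) by (f_equal; ring).
    apply is_lim_seq_plus'; [apply is_lim_seq_const|assumption].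
Qed.

Lemma sum_lt_group6 (f : nat -> R) (n : nat) :
  sum_lt (6 * n) f = sum_lt n (fun j => f (6 * j)%nat + f (6 * j + 1)%nat + f (6 * j + 2)%nat
    + f (6 * j + 3)%nat + f (6 * j + 4)%nat + f (6 * j + 5)%nat).
Proof.
  induction n as [|n IH]; [reflexivity|].
  replace (6 * S n)%nat with (S (S (S (S (S (S (6 * n))))))) by lia.
  rewrite !sum_lt_S, IH.
  replace (6 * n + 1)%nat with (S (6 * n)) by lia.
  replace (6 * n + 2)%nat with (S (S (6 * n))) by lia.
  replace (6 * n + 3)%nat with (S (S (S (6 * n)))) by lia.
  replace (6 * n + 4)%nat with (S (S (S (S (6 * n))))) by lia.
  replace (6 * n + 5)%nat with (S (S (S (S (S (6 * n)))))) by lia.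
  ring.
Qed.

(** * Evaluation at PI/3 and PI/6 *)

Definition inv_sq_sum (r : R) (n : nat) : R := sum_lt n (fun j => / (6 * INR j + r) ^ 2).

(** At multiples of [PI/6] the numerators have period 6 in [k], so the sum splits by the residue of
    [k + 1]. Residue 0 drops out because [sin (12 s + d) = sin d]. *)
Lemma alt_fourier_periodic (p n : nat) (d s : R) : s = INR p * PI / 6 ->
  sum_lt (6 * n) (fun k =>
      (-1) ^ k * (sin (2 * INR (S k) * s + d) - sin d) / (2 * INR (S k) ^ 2)) =
  (sin (2 * s + d) - sin d) / 2 * inv_sq_sum 1 n
  - (sin (4 * s + d) - sin d) / 2 * inv_sq_sum 2 n
  + (sin (6 * s + d) - sin d) / 2 * inv_sq_sum 3 n
  - (sin (8 * s + d) - sin d) / 2 * inv_sq_sum 4 n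
  + (sin (10 * s + d) - sin d) / 2 * inv_sq_sum 5 n.
Proof.
  intros Es. rewrite sum_lt_group6.
  assert (T : forall i j, (-1) ^ (6 * j + i) * (sin (2 * INR (S (6 * j + i)) * s + d) - sin d)
                          / (2 * INR (S (6 * j + i)) ^ 2)
            = ((-1) ^ i * (sin (2 * INR (S i) * s + d) - sin d) / 2) * / (6 * INR j + INR (S i)) ^ 2).
  { intros i j.
    replace (2 * INR (S (6 * j + i)) * s + d) with (2 * INR (S i) * s + d + 2 * INR (p * j) * PI).
    2:{ rewrite Es, !S_INR, plus_INR, !mult_INR. replace (INR 6) with 6 by (simpl; ring). field. }
    rewrite sin_period, pow_add, pow_mult.
    replace ((-1) ^ 6) with 1 by ring. rewrite pow1, Rmult_1_l.
    replace (INR (S (6 * j + i))) with (6 * INR j + INR (S i)).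
    2:{ rewrite !S_INR, plus_INR, mult_INR. replace (INR 6) with 6 by (simpl; ring). ring. }
    assert (0 < INR (S i)) by (apply lt_0_INR; lia). assert (Hj := pos_INR j).
    field. lra. }
  assert (E6 : sin (2 * INR 6 * s + d) = sin d).
  { replace (2 * INR 6 * s + d) with (d + 2 * INR p * PI).
    - apply sin_period.
    - rewrite Es. replace (INR 6) with 6 by (simpl; ring). field. }
  (* The factors [1] put each nested sum in the shape that [sum_lt_lin] splits. *)
  rewrite (sum_lt_ext n _ (fun j =>
    1 * (1 * ((sin (2 * s + d) - sin d) / 2 * / (6 * INR j + 1) ^ 2
          + - (sin (4 * s + d) - sin d) / 2 * / (6 * INR j + 2) ^ 2)
      + 1 * ((sin (6 * s + d) - sin d) / 2 * / (6 * INR j + 3) ^ 2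
          + - (sin (8 * s + d) - sin d) / 2 * / (6 * INR j + 4) ^ 2))
      + (sin (10 * s + d) - sin d) / 2 * / (6 * INR j + 5) ^ 2)).
  - rewrite !sum_lt_lin. unfold inv_sq_sum. field.
  - intros j _. assert (T0 := T O j). rewrite Nat.add_0_r in T0. rewrite T0, !T, E6.
    replace (INR 1) with 1 by (simpl; ring). replace (INR 2) with 2 by (simpl; ring).
    replace (INR 3) with 3 by (simpl; ring). replace (INR 4) with 4 by (simpl; ring).
    replace (INR 5) with 5 by (simpl; ring).
    replace (2 * 1 * s) with (2 * s) by ring. replace (2 * 2 * s) with (4 * s) by ring.
    replace (2 * 3 * s) with (6 * s) by ring. replace (2 * 4 * s) with (8 * s) by ring.
    replace (2 * 5 * s) with (10 * s) by ring.
    assert (Hj := pos_INR j). simpl pow. field. repeat split; lra.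
Qed.

Lemma is_lim_seq_mult_index (a : nat) (u : nat -> R) (l : R) : (0 < a)%nat ->
  is_lim_seq u l -> is_lim_seq (fun n => u (a * n)%nat) l.
Proof.
  intros Ha. apply (is_lim_seq_subseq u l (fun n => (a * n)%nat)).
  apply eventually_subseq. intros n. nia.
Qed.

(** In terms of the Clausen function this is [Cl_2(PI - 2 s) / 2]. *)
Definition lncos_int (s : R) : R := RInt (fun u => ln (2 * cos u)) 0 s.

Lemma lncos_continuous (u : R) : - (PI / 2) < u < PI / 2 ->
  continuous (fun u => ln (2 * cos u)) u.
Proof.
  intros Hu.
  apply (ex_derive_continuous (K := R_AbsRing) (V := R_NormedModule) (fun u => ln (2 * cos u)) u).
  assert (0 < cos u) by (apply cos_gt_0; lra).
  auto_derive. lra.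
Qed.

Lemma is_derive_lncos_int (u : R) : - (PI / 2) < u < PI / 2 ->
  is_derive lncos_int u (ln (2 * cos u)).
Proof.
  intros Hu. apply (is_derive_RInt (V := R_NormedModule) (fun u => ln (2 * cos u)) lncos_int 0); [|now apply lncos_continuous].
  apply (locally_open_interval (- (PI / 2)) (PI / 2)); [assumption|]. intros y Hy.
  apply (RInt_correct (V := R_CompleteNormedModule)).
  apply (ex_RInt_continuous (V := R_CompleteNormedModule)).
  intros z Hz. apply lncos_continuous.
  revert Hz. apply Rmin_case; apply Rmax_case; intros; lra.
Qed.

Lemma lncos_int_series (s : R) : 0 <= s <= PI / 3 ->
  is_lim_seq (fun N => sum_lt N (fun k =>
      (-1) ^ k * (sin (2 * INR (S k) * s + 0) - sin 0) / (2 * INR (S k) ^ 2))) (lncos_int s).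
Proof.
  intros Hs. assert (HP := PI_RGT_0).
  replace (lncos_int s) with (lncos_int s - lncos_int 0).
  - apply (alt_fourier_integrated 0 (fun u => ln (2 * cos u))); [| | |assumption].
    + intros u Hu. apply cos_ge_half in Hu. rewrite Rplus_0_r. auto_derive; [lra|field; lra].
    + now rewrite cos_0, Rmult_1_r, Rmult_1_l.
    + intros u Hu. apply is_derive_lncos_int. lra.
  - unfold lncos_int at 2. rewrite (RInt_point (V := R_CompleteNormedModule)).
    unfold zero; simpl. ring.
Qed.

Lemma sin_sixth_turns :
  sin (PI / 3) = sqrt 3 / 2 /\ sin (2 * (PI / 3)) = sqrt 3 / 2 /\ sin (3 * (PI / 3)) = 0 /\
  sin (4 * (PI / 3)) = - (sqrt 3 / 2) /\ sin (5 * (PI / 3)) = - (sqrt 3 / 2) /\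
  (forall x, sin (x + 6 * (PI / 3)) = sin x).
Proof.
  assert (H1 := sin_PI3).
  assert (H2 : sin (2 * (PI / 3)) = sqrt 3 / 2).
  { replace (2 * (PI / 3)) with (PI - PI / 3) by field. now rewrite sin_PI_x. }
  repeat split; try assumption.
  - replace (3 * (PI / 3)) with PI by field. apply sin_PI.
  - replace (4 * (PI / 3)) with (PI / 3 + PI) by field. now rewrite neg_sin, H1.
  - replace (5 * (PI / 3)) with (2 * (PI / 3) + PI) by field. now rewrite neg_sin, H2.
  - intros x. replace (x + 6 * (PI / 3)) with (x + 2 * PI) by field.
    rewrite sin_plus, sin_2PI, cos_2PI. ring.
Qed.

Lemma cos_sixth_turns :
  cos (2 * (PI / 3)) = - (1 / 2) /\ cos (4 * (PI / 3)) = - (1 / 2) /\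
  (forall x, cos (x + 6 * (PI / 3)) = cos x).
Proof.
  assert (H1 := cos_PI3).
  repeat split.
  - replace (2 * (PI / 3)) with (- (PI / 3) + PI) by field. rewrite neg_cos, cos_neg. lra.
  - replace (4 * (PI / 3)) with (PI / 3 + PI) by field. rewrite neg_cos. lra.
  - intros x. replace (x + 6 * (PI / 3)) with (x + 2 * PI) by field.
    rewrite cos_plus, sin_2PI, cos_2PI. ring.
Qed.

Lemma inv_sq_sum_lncos_PI3 :
  is_lim_seq (fun n => inv_sq_sum 1 n + inv_sq_sum 2 n - inv_sq_sum 4 n - inv_sq_sum 5 n)
    (4 / sqrt 3 * lncos_int (PI / 3)).
Proof.
  assert (HP := PI_RGT_0). assert (Hq : 0 < sqrt 3) by (apply sqrt_lt_R0; lra).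
  assert (H := lncos_int_series (PI / 3) ltac:(lra)).
  apply (is_lim_seq_mult_index 6) in H; [|lia].
  apply (is_lim_seq_scal_l _ (4 / sqrt 3)) in H.
  eapply is_lim_seq_ext; [|exact H]. intros n. cbv beta.
  rewrite (alt_fourier_periodic 2) by (simpl INR; field).
  destruct sin_sixth_turns as (h1 & h2 & h3 & h4 & h5 & h6).
  rewrite sin_0, !Rplus_0_r, h2, h4.
  replace (6 * (PI / 3)) with (0 + 6 * (PI / 3)) by ring. rewrite h6, sin_0.
  replace (8 * (PI / 3)) with (2 * (PI / 3) + 6 * (PI / 3)) by ring. rewrite h6, h2.
  replace (10 * (PI / 3)) with (4 * (PI / 3) + 6 * (PI / 3)) by ring. rewrite h6, h4.
  field. lra.
Qed.

Lemma inv_sq_sum_lncos_PI6 :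
  is_lim_seq (fun n => inv_sq_sum 1 n - inv_sq_sum 2 n + inv_sq_sum 4 n - inv_sq_sum 5 n)
    (4 / sqrt 3 * lncos_int (PI / 6)).
Proof.
  assert (HP := PI_RGT_0). assert (Hq : 0 < sqrt 3) by (apply sqrt_lt_R0; lra).
  assert (H := lncos_int_series (PI / 6) ltac:(lra)).
  apply (is_lim_seq_mult_index 6) in H; [|lia].
  apply (is_lim_seq_scal_l _ (4 / sqrt 3)) in H.
  eapply is_lim_seq_ext; [|exact H]. intros n. cbv beta.
  rewrite (alt_fourier_periodic 1) by (simpl INR; field).
  destruct sin_sixth_turns as (h1 & h2 & h3 & h4 & h5 & h6).
  rewrite sin_0, !Rplus_0_r.
  replace (2 * (PI / 6)) with (PI / 3) by field. rewrite h1.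
  replace (4 * (PI / 6)) with (2 * (PI / 3)) by field. rewrite h2.
  replace (6 * (PI / 6)) with (3 * (PI / 3)) by field. rewrite h3.
  replace (8 * (PI / 6)) with (4 * (PI / 3)) by field. rewrite h4.
  replace (10 * (PI / 6)) with (5 * (PI / 3)) by field. rewrite h5.
  field. lra.
Qed.

(* The phase PI/2 turns the series of [ln (2 cos s)] into that of [- s]: this
   is the Basel problem for the integers prime to 3. *)
Lemma inv_sq_sum_basel :
  is_lim_seq (fun n => inv_sq_sum 1 n - inv_sq_sum 2 n - inv_sq_sum 4 n + inv_sq_sum 5 n)
    (2 * PI ^ 2 / 27).
Proof.
  assert (HP := PI_RGT_0).
  assert (H : is_lim_seq (fun N => sum_lt N (fun k =>
      (-1) ^ k * (sin (2 * INR (S k) * (PI / 3) + PI / 2) - sin (PI / 2)) / (2 * INR (S k) ^ 2)))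
      (- ((PI / 3) ^ 2 / 2) - - (0 ^ 2 / 2))).
  { apply (alt_fourier_integrated (PI / 2) (fun u => - u) (fun u => - (u ^ 2 / 2))).
    - intros u Hu. apply cos_ge_half in Hu.
      replace (sin (u + PI / 2)) with (cos u) by (rewrite sin_plus, cos_PI2, sin_PI2; ring).
      auto_derive; [trivial|field; lra].
    - rewrite cos_PI2. ring.
    - intros u _. auto_derive; [trivial|field].
    - lra. }
  apply (is_lim_seq_mult_index 6) in H; [|lia].
  apply (is_lim_seq_scal_l _ (- (4 / 3))) in H.
  replace (Finite (2 * PI ^ 2 / 27))
    with (Rbar_mult (- (4 / 3)) (- ((PI / 3) ^ 2 / 2) - - (0 ^ 2 / 2)))
    by (simpl; f_equal; field).
  eapply is_lim_seq_ext; [|exact H]. intros n. cbv beta.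
  rewrite (alt_fourier_periodic 2) by (simpl INR; field).
  destruct cos_sixth_turns as (h2 & h4 & h6).
  assert (C : forall x, sin (x + PI / 2) = cos x)
    by (intros; rewrite sin_plus, cos_PI2, sin_PI2; ring).
  rewrite sin_PI2, !C, h2, h4.
  replace (6 * (PI / 3)) with (0 + 6 * (PI / 3)) by ring. rewrite h6, cos_0.
  replace (8 * (PI / 3)) with (2 * (PI / 3) + 6 * (PI / 3)) by ring. rewrite h6, h2.
  replace (10 * (PI / 3)) with (4 * (PI / 3) + 6 * (PI / 3)) by ring. rewrite h6, h4.
  field.
Qed.

(** Split by the parity of the index: [6 (2 i) + 2 r = 2 (6 i + r)] and
    [6 (2 i + 1) + 2 r = 2 (6 i + r + 3)]. *)
Lemma inv_sq_sum_double (r : R) (n : nat) : 0 < r ->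
  4 * inv_sq_sum (2 * r) (2 * n) = inv_sq_sum r n + inv_sq_sum (r + 3) n.
Proof.
  intros Hr. unfold inv_sq_sum. induction n as [|n IH]; [unfold sum_lt; simpl; ring|].
  replace (2 * S n)%nat with (S (S (2 * n))) by lia.
  rewrite !sum_lt_S, !Rmult_plus_distr_l, IH.
  rewrite S_INR, mult_INR. change (INR 2) with 2. assert (Hn := pos_INR n).
  field. repeat split; lra.
Qed.

Lemma trigamma_inv_sq_sum (r : R) : 0 < r < 6 ->
  is_lim_seq (inv_sq_sum r) (trigamma (r / 6) / 36).
Proof.
  intros Hr. assert (H := trigamma_series (r / 6) ltac:(lra)).
  apply (is_lim_seq_scal_l _ (/ 36)) in H.
  replace (Finite (trigamma (r / 6) / 36)) with (Rbar_mult (/ 36) (trigamma (r / 6)))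
    by (simpl; f_equal; field).
  eapply is_lim_seq_ext; [|exact H]. intros n. cbv beta.
  unfold inv_sq_sum. rewrite <- sum_lt_scal. apply sum_lt_ext. intros k _.
  assert (Hk := pos_INR k). field. lra.
Qed.

Lemma lncos_int_trigamma :
  2 / sqrt 3 * (lncos_int (PI / 3) - 6 * lncos_int (PI / 6)) =
  (trigamma (5 / 6) - trigamma (1 / 3)) / 12 - PI ^ 2 / 9.
Proof.
  assert (L : forall r, 0 < r < 6 -> is_lim_seq (inv_sq_sum r) (trigamma (r / 6) / 36))
    by apply trigamma_inv_sq_sum.
  assert (U : forall (u v : nat -> R) (a b : R), (forall n, u n = v n) ->
            is_lim_seq u a -> is_lim_seq v b -> a = b).
  { intros u v a b E Hu Hv. apply (is_lim_seq_ext _ _ _ E) in Hu.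
    apply is_lim_seq_unique in Hu, Hv. rewrite Hu in Hv. now injection Hv. }
  assert (L1 := L 1 ltac:(lra)). assert (L2 := L 2 ltac:(lra)).
  assert (L4 := L 4 ltac:(lra)). assert (L5 := L 5 ltac:(lra)).
  replace (2 / 6) with (1 / 3) in L2 by field.
  set (t1 := trigamma (1 / 6)) in *. set (t2 := trigamma (1 / 3)) in *.
  set (t4 := trigamma (4 / 6)) in *. set (t5 := trigamma (5 / 6)) in *.
  assert (E3 := U _ _ _ _ (fun n => eq_refl) inv_sq_sum_lncos_PI3
    (is_lim_seq_minus' _ _ _ _ (is_lim_seq_minus' _ _ _ _ (is_lim_seq_plus' _ _ _ _ L1 L2) L4) L5)).
  assert (E6 := U _ _ _ _ (fun n => eq_refl) inv_sq_sum_lncos_PI6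
    (is_lim_seq_minus' _ _ _ _ (is_lim_seq_plus' _ _ _ _ (is_lim_seq_minus' _ _ _ _ L1 L2) L4) L5)).
  assert (EB := U _ _ _ _ (fun n => eq_refl) inv_sq_sum_basel
    (is_lim_seq_plus' _ _ _ _ (is_lim_seq_minus' _ _ _ _ (is_lim_seq_minus' _ _ _ _ L1 L2) L4) L5)).
  assert (D : forall r, 0 < r -> forall a b c : R, is_lim_seq (inv_sq_sum (2 * r)) a ->
            is_lim_seq (inv_sq_sum r) b -> is_lim_seq (inv_sq_sum (r + 3)) c -> 4 * a = b + c).
  { intros r Hr a b c Ha Hb Hc.
    apply (is_lim_seq_mult_index 2) in Ha; [|lia].
    apply (is_lim_seq_scal_l _ 4) in Ha.
    exact (U _ _ _ _ (fun n => inv_sq_sum_double r n Hr) Ha (is_lim_seq_plus' _ _ _ _ Hb Hc)). }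
  assert (D1 := D 1 ltac:(lra)). assert (D2 := D 2 ltac:(lra)).
  replace (2 * 1) with 2 in D1 by ring. replace (1 + 3) with 4 in D1 by ring.
  replace (2 * 2) with 4 in D2 by ring. replace (2 + 3) with 5 in D2 by ring.
  specialize (D1 _ _ _ L2 L1 L4). specialize (D2 _ _ _ L4 L2 L5).
  (* By [E3] and [E6] the left side is [(- 5 t1 + 7 t2 - 7 t4 + 5 t5) / 72]; the duplications reduce
     it to [(t5 - 3 t2) / 16]. They also turn the Basel relation into [5 t2 + t5 = 16 PI^2 / 3],
     which converts this to the form claimed. *)
  unfold Rdiv in *. lra.
Qed.

(** * The integral at th = PI *)

Lemma derive_zero_constant (f : R -> R) (a b : R) : a <= b ->
  (forall x, a <= x <= b -> is_derive f x 0) -> f b = f a.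
Proof.
  intros Hab Hf.
  assert (H := derive_dominated f (fun _ => 0) (fun _ => 0) (fun _ => 0) a b Hab Hf
    (fun x _ => is_derive_const (V := R_NormedModule) 0 x)).
  assert (H0 : Rabs (f b - f a) <= 0).
  { eapply Rle_trans; [apply H|]; intros; rewrite ?Rabs_R0; lra. }
  assert (E : Rabs (f b - f a) = 0) by (generalize (Rabs_pos (f b - f a)); lra).
  destruct (Req_dec (f b - f a) 0) as [|N]; [lra|]. now apply Rabs_no_R0 in N.
Qed.

(** In the substitution for J(PI) the argument [PI/6 - u] runs down to [- PI/6]. *)
Lemma lncos_int_odd (s : R) : 0 <= s < PI / 2 -> lncos_int (- s) = - lncos_int s.
Proof.
  intros Hs.
  assert (H := derive_zero_constant (fun u => lncos_int u + lncos_int (- u)) 0 s ltac:(lra)).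
  assert (Z : lncos_int 0 = 0).
  { unfold lncos_int. apply (RInt_point (V := R_CompleteNormedModule)). }
  cbv beta in H. rewrite Ropp_0, Z in H. enough (lncos_int s + lncos_int (- s) = 0 + 0) by lra.
  apply H. intros x Hx.
  replace 0 with (ln (2 * cos x) + (-1) * ln (2 * cos (- x))) by (rewrite cos_neg; ring).
  apply (is_derive_plus (V := R_NormedModule) lncos_int (fun u => lncos_int (- u))).
  - apply is_derive_lncos_int. lra.
  - apply (is_derive_comp lncos_int Ropp).
    + apply is_derive_lncos_int. lra.
    + auto_derive; [trivial|ring].
Qed.

Lemma RInt_ln_cube_add_1 :
  RInt (fun x => ln (x ^ 3 + 1) / (x ^ 2 - x + 1)) 0 1 =
  PI / sqrt 3 * ln 3 + 2 / sqrt 3 * (lncos_int (PI / 3) - 6 * lncos_int (PI / 6)).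
Proof.
  set (f := fun x => ln (x ^ 3 + 1) / (x ^ 2 - x + 1)).
  assert (HP := PI_RGT_0). assert (Hq : 0 < sqrt 3) by (apply sqrt_lt_R0; lra).
  assert (Hqq : sqrt 3 * sqrt 3 = 3) by (apply sqrt_sqrt; lra).
  (* Continuity beyond [[0, 1]] gives [F] a two-sided derivative at both endpoints. *)
  assert (Hc : forall x, -1 < x -> continuous f x).
  { intros x Hx. apply (ex_derive_continuous (K := R_AbsRing) (V := R_NormedModule) f x).
    unfold f. auto_derive. split; [|split; [|trivial]].
    - replace (x * (x * (x * 1)) + 1) with ((x + 1) * ((x - 1 / 2) ^ 2 + 3 / 4)) by field.
      apply Rmult_lt_0_compat; [lra|]. generalize (pow2_ge_0 (x - 1 / 2)). lra.
    - generalize (pow2_ge_0 (x - 1 / 2)). intros; apply Rgt_not_eq; simpl in *; lra. }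
  set (F := fun x => RInt f 0 x).
  assert (HF : forall x, -1 < x -> is_derive F x (f x)).
  { intros x Hx. apply (is_derive_RInt (V := R_NormedModule) f F 0); [|now apply Hc].
    apply (locally_open_interval (-1) (x + 1)); [lra|]. intros y Hy.
    apply (RInt_correct (V := R_CompleteNormedModule)).
    apply (ex_RInt_continuous (V := R_CompleteNormedModule)).
    intros z Hz. apply Hc. revert Hz. apply Rmin_case; intros; lra. }
  set (g := fun u => sin (PI / 3 - u) / sin (PI / 3 + u)).
  (* With [x = g u] one has [dx / (x^2 - x + 1) = - (2 / sqrt 3) du] and [ln (x^3 + 1) = 3/2 ln 3 +
     ln (2 cos u) - 3 ln (2 cos (PI/6 - u))]. [Phi] is a primitive of minus the transformed
     integrand, so [F (g u) + Phi u] is constant; [g] runs from 1 to 0. *)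
  set (Phi := fun u => 2 / sqrt 3 * (3 / 2 * ln 3 * u + (lncos_int u + 3 * lncos_int (PI / 6 - u)))).
  assert (H := derive_zero_constant (fun u => F (g u) + Phi u) 0 (PI / 3) ltac:(lra)).
  assert (F0 : F 0 = 0) by apply (RInt_point (V := R_CompleteNormedModule)).
  assert (G0 : g 0 = 1).
  { unfold g. rewrite Rminus_0_r, Rplus_0_r. field.
    apply Rgt_not_eq, sin_gt_0; lra. }
  assert (G1 : g (PI / 3) = 0).
  { unfold g. rewrite Rminus_diag, sin_0. unfold Rdiv. ring. }
  assert (Z : lncos_int 0 = 0) by apply (RInt_point (V := R_CompleteNormedModule)).
  cbv beta in H. rewrite G0, G1, F0 in H. unfold Phi in H.
  replace (PI / 6 - PI / 3) with (- (PI / 6)) in H by field.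
  rewrite Z, Rminus_0_r, lncos_int_odd, !Rmult_0_r in H by lra.
  change (F 1 = PI / sqrt 3 * ln 3 + 2 / sqrt 3 * (lncos_int (PI / 3) - 6 * lncos_int (PI / 6))).
  apply (Rplus_eq_reg_r (2 / sqrt 3 * (0 + (0 + 3 * lncos_int (PI / 6))))). rewrite <- H.
  { field. lra. }
  clear H. intros u Hu. fold Phi.
  assert (HS : 0 < sin (PI / 3 + u)) by (apply sin_gt_0; lra).
  assert (HS' : 0 <= sin (PI / 3 - u)) by (apply sin_ge_0; lra).
  assert (Hcu := cos_ge_half u Hu).
  assert (Hg : 0 <= g u) by (apply Rmult_le_pos; [lra|left; now apply Rinv_0_lt_compat]).
  assert (ES : cos (PI / 6 - u) = sin (PI / 3 + u)).
  { rewrite <- cos_shift. f_equal. field. }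
  set (S := sin (PI / 3 + u)) in *.
  assert (E1 : g u + 1 = sqrt 3 * cos u / S).
  { unfold g. fold S. replace (sqrt 3 * cos u) with (sin (PI / 3 - u) + S); [field; lra|].
    unfold S. rewrite sin_plus, sin_minus, sin_PI3. field. }
  assert (E2 : (g u) ^ 2 - g u + 1 = 3 / 4 / S ^ 2).
  { unfold g. fold S.
    replace (3 / 4) with (sin (PI / 3 - u) ^ 2 - sin (PI / 3 - u) * S + S ^ 2); [field; lra|].
    unfold S. rewrite sin_plus, sin_minus, sin_PI3, cos_PI3.
    generalize (sin2_cos2 u). unfold Rsqr. intros E.
    replace ((sqrt 3 / 2 * cos u - 1 / 2 * sin u) ^ 2
             - (sqrt 3 / 2 * cos u - 1 / 2 * sin u) * (sqrt 3 / 2 * cos u + 1 / 2 * sin u)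
             + (sqrt 3 / 2 * cos u + 1 / 2 * sin u) ^ 2)
      with (sqrt 3 * sqrt 3 / 4 * (cos u * cos u) + 3 / 4 * (sin u * sin u)) by field.
    rewrite Hqq. lra. }
  assert (E3 : ln (g u ^ 3 + 1) = 3 / 2 * ln 3 + ln (2 * cos u) - 3 * ln (2 * S)).
  { replace (g u ^ 3 + 1) with ((g u + 1) * (g u ^ 2 - g u + 1)) by ring.
    rewrite E1, E2.
    replace (sqrt 3 * cos u / S * (3 / 4 / S ^ 2)) with (3 * sqrt 3 * (2 * cos u) / (2 * S) ^ 3)
      by (field; lra).
    assert (L3 : ln 3 = ln (sqrt 3) + ln (sqrt 3)) by (rewrite <- ln_mult, Hqq by lra; reflexivity).
    rewrite ln_div, (ln_mult (3 * sqrt 3)), (ln_mult 3), ln_pow by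
      (try apply pow_lt; try apply Rmult_lt_0_compat; lra).
    simpl INR. rewrite L3 at 1 2. field. }
  replace 0 with ((- (sqrt 3 / 2) / S ^ 2) * f (g u)
     + 2 / sqrt 3 * (3 / 2 * ln 3 + (ln (2 * cos u) + 3 * ((-1) * ln (2 * cos (PI / 6 - u)))))).
  2:{ unfold f. rewrite E3, E2, ES.
      replace (- (sqrt 3 / 2) / S ^ 2) with (- (sqrt 3 * sqrt 3 / (2 * sqrt 3)) / S ^ 2)
        by (field; lra).
      rewrite Hqq. field. lra. }
  apply (is_derive_plus (V := R_NormedModule) (fun u => F (g u)) Phi).
  - apply (is_derive_comp F g); [apply HF; lra|].
    unfold g. auto_derive; [fold S; lra|].
    replace (sqrt 3 / 2) with (sin (PI / 3 - u) * cos (PI / 3 + u) + cos (PI / 3 - u) * S).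
    { change (PI / 3 + - u) with (PI / 3 - u). fold S. field. lra. }
    unfold S. rewrite <- sin_plus. replace (PI / 3 - u + (PI / 3 + u)) with (PI - PI / 3) by field.
    now rewrite sin_PI_x, sin_PI3.
  - apply is_derive_scal.
    apply (is_derive_plus (V := R_NormedModule) (fun u => 3 / 2 * ln 3 * u)).
    { auto_derive; [trivial|ring]. }
    apply (is_derive_plus (V := R_NormedModule) lncos_int (fun u => 3 * lncos_int (PI / 6 - u))).
    { apply is_derive_lncos_int. lra. }
    apply is_derive_scal.
    apply (is_derive_comp lncos_int (fun u => PI / 6 - u)).
    + apply is_derive_lncos_int. lra.
    + auto_derive; [trivial|ring].
Qed.

(** * Dependence on th *)

(** This is the squared modulus of [x^3 - exp(i th)]. *)
Definition trinomial (th x : R) : R := x ^ 6 - 2 * cos th * x ^ 3 + 1.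

Definition log_trinomial_int (th : R) : R :=
  RInt (fun x => ln (trinomial th x) / (x ^ 2 - x + 1)) 0 1.

Lemma sqr_sub_add_1_pos (x : R) : 0 < x ^ 2 - x + 1.
Proof.
  replace (x ^ 2 - x + 1) with ((x - 1 / 2) ^ 2 + 3 / 4) by field.
  generalize (pow2_ge_0 (x - 1 / 2)). lra.
Qed.

(** The value is [(1 - x^3)^2 + 4 sin^2 (th/2) x^3]. The range goes past [PI] because a two-sided
    derivative in th is wanted at the base point [PI]. *)
Lemma trinomial_pos (th x : R) : 0 < th < 2 * PI -> 0 <= x -> 0 < trinomial th x.
Proof.
  intros Ht Hx.
  assert (Hs : 0 < sin (th / 2)) by (apply sin_gt_0; lra).
  assert (Hc : cos th = 1 - 2 * sin (th / 2) * sin (th / 2)).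
  { rewrite <- cos_2a_sin. f_equal. field. }
  unfold trinomial. rewrite Hc.
  replace (x ^ 6 - 2 * (1 - 2 * sin (th / 2) * sin (th / 2)) * x ^ 3 + 1)
    with ((1 - x ^ 3) ^ 2 + 4 * (sin (th / 2) * sin (th / 2)) * x ^ 3) by ring.
  assert (0 < sin (th / 2) * sin (th / 2)) by now apply Rmult_lt_0_compat.
  destruct Hx as [Hx|<-].
  - apply Rplus_le_lt_0_compat; [apply pow2_ge_0|].
    apply Rmult_lt_0_compat; [lra|now apply pow_lt].
  - simpl. lra.
Qed.

Lemma trinomial_continuity_2d (th x : R) : continuity_2d_pt trinomial th x.
Proof.
  apply continuity_2d_pt_ext with
    (fun u v => (v * v * v) * (v * v * v) - 2 * cos u * (v * v * v) + 1).
  { intros u v. unfold trinomial. ring. }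
  assert (Hv : continuity_2d_pt (fun _ v : R => v) th x) by apply continuity_2d_pt_id2.
  assert (Hv3 : continuity_2d_pt (fun _ v : R => v * v * v) th x)
    by (repeat apply continuity_2d_pt_mult; assumption).
  apply continuity_2d_pt_plus; [|apply continuity_2d_pt_const].
  apply continuity_2d_pt_minus; apply continuity_2d_pt_mult; try assumption.
  apply continuity_2d_pt_mult; [apply continuity_2d_pt_const|].
  apply (continuity_1d_2d_pt_comp cos (fun u _ => u)); [apply continuity_cos|].
  apply continuity_2d_pt_id1.
Qed.

Lemma is_derive_ln_trinomial (th x : R) : 0 < trinomial th x ->
  is_derive (fun th => ln (trinomial th x) / (x ^ 2 - x + 1)) th
    (2 * sin th * x ^ 3 / (trinomial th x * (x ^ 2 - x + 1))).
Proof.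
  intros H. assert (Hq := sqr_sub_add_1_pos x). unfold trinomial in *.
  auto_derive.
  - eapply Rlt_le_trans; [exact H|]. right. ring.
  - field. split; lra.
Qed.

Lemma ex_RInt_ln_trinomial (th : R) : 0 < th < 2 * PI ->
  ex_RInt (fun x => ln (trinomial th x) / (x ^ 2 - x + 1)) 0 1.
Proof.
  intros Ht. apply (ex_RInt_continuous (V := R_CompleteNormedModule)).
  intros x. rewrite Rmin_left, Rmax_right by lra. intros Hx.
  assert (H := trinomial_pos th x Ht ltac:(lra)). assert (Hq := sqr_sub_add_1_pos x).
  apply (ex_derive_continuous (K := R_AbsRing) (V := R_NormedModule)
           (fun x => ln (trinomial th x) / (x ^ 2 - x + 1)) x).
  unfold trinomial in *. auto_derive. repeat split.
  - eapply Rlt_le_trans; [exact H|]. right. ring.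
  - apply Rgt_not_eq. eapply Rlt_le_trans; [exact Hq|]. right. ring.
Qed.

Lemma is_derive_log_trinomial_int (th : R) : 0 < th < 2 * PI ->
  is_derive log_trinomial_int th
    (RInt (fun x => 2 * sin th * x ^ 3 / (trinomial th x * (x ^ 2 - x + 1))) 0 1).
Proof.
  intros Ht.
  assert (Hloc : locally th (fun y => 0 < y < 2 * PI)).
  { now apply (locally_open_interval 0 (2 * PI)). }
  rewrite <- (RInt_ext (V := R_CompleteNormedModule)
    (fun x => Derive (fun u => ln (trinomial u x) / (x ^ 2 - x + 1)) th)).
  2:{ intros x. rewrite Rmin_left, Rmax_right by lra. intros Hx.
      apply is_derive_unique, is_derive_ln_trinomial, trinomial_pos; [assumption|lra]. }
  apply (is_derive_RInt_param (fun u x => ln (trinomial u x) / (x ^ 2 - x + 1)) 0 1 th).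
  - revert Hloc. apply filter_imp. intros y Hy x. rewrite Rmin_left, Rmax_right by lra. intros Hx.
    eexists. apply is_derive_ln_trinomial, trinomial_pos; [assumption|lra].
  - intros x. rewrite Rmin_left, Rmax_right by lra. intros Hx.
    assert (H := trinomial_pos th x Ht ltac:(lra)). assert (Hq := sqr_sub_add_1_pos x).
    assert (HG := trinomial_continuity_2d th x).
    apply continuity_2d_pt_ext_loc with
      (fun u v => (2 * sin u * (v * v * v)) * / (trinomial u v * (v * v - v + 1))).
    (* Taking the tolerance to be [trinomial th x] itself keeps the trinomial positive nearby, where
       the derivative formula is valid. *)
    + destruct (HG (mkposreal _ H)) as [d Hd]. exists d. intros u v Hu Hv.
      specialize (Hd u v Hu Hv). simpl in Hd. apply Rabs_def2 in Hd.
      symmetry. apply is_derive_unique.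
      replace (2 * sin u * (v * v * v) * / (trinomial u v * (v * v - v + 1)))
        with (2 * sin u * v ^ 3 / (trinomial u v * (v ^ 2 - v + 1))).
      * apply is_derive_ln_trinomial. lra.
      * unfold Rdiv. f_equal; [ring|]. do 2 f_equal. ring.
    + assert (Hv : continuity_2d_pt (fun _ v : R => v) th x) by apply continuity_2d_pt_id2.
      apply continuity_2d_pt_mult.
      * apply continuity_2d_pt_mult; [|repeat apply continuity_2d_pt_mult; assumption].
        apply continuity_2d_pt_mult; [apply continuity_2d_pt_const|].
        apply (continuity_1d_2d_pt_comp sin (fun u _ => u)); [apply continuity_sin|].
        apply continuity_2d_pt_id1.
      * apply continuity_2d_pt_inv.
        -- apply continuity_2d_pt_mult; [assumption|].
           apply continuity_2d_pt_plus; [|apply continuity_2d_pt_const].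
           apply continuity_2d_pt_minus; [apply continuity_2d_pt_mult|]; assumption.
        -- apply Rgt_not_eq, Rmult_lt_0_compat; [assumption|].
           eapply Rlt_le_trans; [exact Hq|]. right. ring.
  - revert Hloc. apply filter_imp. intros y Hy. now apply ex_RInt_ln_trinomial.
Qed.

(** * Partial fractions over the trisected angle *)

Lemma RInt_inv_quadratic (b : R) : 0 < b < PI ->
  is_RInt (fun x => sin b / (x ^ 2 - 2 * cos b * x + 1)) 0 1 ((PI - b) / 2).
Proof.
  intros Hb. assert (HP := PI_RGT_0).
  assert (Hs : 0 < sin b) by (apply sin_gt_0; lra).
  assert (Hsc := sin2_cos2 b). unfold Rsqr in Hsc.
  assert (Hpos := fun x => quadratic_cos_pos b x Hs).
  (* The primitive [atan ((x - cos b) / sin b)] equals [b / 2] at 1 and [b - PI/2] at 0. *)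
  replace ((PI - b) / 2)
    with (minus (atan ((1 - cos b) / sin b)) (atan ((0 - cos b) / sin b))).
  - apply (is_RInt_derive (fun x => atan ((x - cos b) / sin b))).
    + intros x _. specialize (Hpos x). auto_derive; [lra|].
      assert (H : 1 + (x + - cos b) * / sin b * ((x + - cos b) * / sin b * 1) = (x ^ 2 - 2 * cos b * x + 1) / (sin b * sin b)).
      { replace (x ^ 2 - 2 * cos b * x + 1) with ((x - cos b) ^ 2 + sin b * sin b).
        - field. lra.
        - rewrite <- Hsc. ring. }
      rewrite H. field. split; lra.
    + intros x _. specialize (Hpos x).
      apply (ex_derive_continuous (K := R_AbsRing) (V := R_NormedModule)
               (fun x => sin b / (x ^ 2 - 2 * cos b * x + 1)) x).
      auto_derive. apply Rgt_not_eq. eapply Rlt_le_trans; [exact Hpos|]. right. ring.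
  - assert (E1 : (1 - cos b) / sin b = tan (b / 2)).
    { assert (0 < cos (b / 2)) by (apply cos_gt_0; lra).
      assert (0 < sin (b / 2)) by (apply sin_gt_0; lra).
      replace b with (2 * (b / 2)) at 1 2 by field.
      rewrite cos_2a_sin, sin_2a. unfold tan. field. lra. }
    assert (E2 : (0 - cos b) / sin b = tan (b - PI / 2)).
    { unfold tan. rewrite sin_minus, cos_minus, cos_PI2, sin_PI2. field. lra. }
    rewrite E1, E2, !atan_tan by lra.
    unfold minus, plus, opp; simpl. field.
Qed.

Lemma RInt_inv_sqr_sub_add_1 :
  is_RInt (fun x => / (x ^ 2 - x + 1)) 0 1 (2 * PI / (3 * sqrt 3)).
Proof.
  assert (HP := PI_RGT_0). assert (Hq : 0 < sqrt 3) by (apply sqrt_lt_R0; lra).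
  assert (H := RInt_inv_quadratic (PI / 3) ltac:(lra)). rewrite sin_PI3, cos_PI3 in H.
  apply (is_RInt_scal (V := R_NormedModule) _ _ _ (2 / sqrt 3)) in H.
  replace (2 * PI / (3 * sqrt 3)) with (scal (2 / sqrt 3) ((PI - PI / 3) / 2)).
  - eapply is_RInt_ext; [|exact H]. intros x _. assert (Hx := sqr_sub_add_1_pos x).
    unfold scal; simpl; unfold mult; simpl.
    replace (2 * (1 / 2) * x) with x by field. simpl in Hx. field. split; lra.
  - unfold scal; simpl; unfold mult; simpl. field. lra.
Qed.

(* Here [C], [S] are the cosine and sine of [th / 3] and [r = sqrt 3]; the
   three fractions belong to the angles [th/3], [(2 PI + th)/3], [(2 PI - th)/3],
   whose doubled cosines are the roots of [y^3 - 3 y = 2 cos th]. *)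
Lemma trisection_partial_fractions (C S r x : R) :
  r * r = 3 -> S * S + C * C = 1 -> 1 < 2 * C -> 0 < S ->
  0 < x ^ 2 - 2 * C * x + 1 ->
  0 < x ^ 2 - 2 * (- C / 2 - r / 2 * S) * x + 1 ->
  0 < x ^ 2 - 2 * (- C / 2 + r / 2 * S) * x + 1 ->
  2 * (- C / 2 - r / 2 * S) - 1 < 0 ->
  2 * (- C / 2 + r / 2 * S) - 1 < 0 ->
  0 < x ^ 2 - x + 1 ->
  2 * (S * (4 * C ^ 2 - 1)) * x ^ 3
    / ((x ^ 6 - 2 * (4 * C ^ 3 - 3 * C) * x ^ 3 + 1) * (x ^ 2 - x + 1)) =
  2 / (3 * (2 * C - 1)) * (S / (x ^ 2 - 2 * C * x + 1))
  + 2 / (3 * (2 * (- C / 2 - r / 2 * S) - 1))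
      * ((r / 2 * C - S / 2) / (x ^ 2 - 2 * (- C / 2 - r / 2 * S) * x + 1))
  - 2 / (3 * (2 * (- C / 2 + r / 2 * S) - 1))
      * ((r / 2 * C + S / 2) / (x ^ 2 - 2 * (- C / 2 + r / 2 * S) * x + 1))
  - S * (4 * C ^ 2 - 1) / (1 + (4 * C ^ 3 - 3 * C)) * / (x ^ 2 - x + 1).
Proof.
  intros Hr HS HC HSp Ha Hb Hc Hyb Hyc Hq.
  set (qa := x ^ 2 - 2 * C * x + 1) in *.
  (* The relations [r^2 = 3] and [S^2 + C^2 = 1] are invisible to [field]. They enter only through
     the symmetric combinations [EW], [EY], [EN] of the last two angles; what remains is a rational
     identity. *)
  set (W := x ^ 4 + 2 * C * x ^ 3 + (4 * C ^ 2 - 1) * x ^ 2 + 2 * C * x + 1).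
  assert (EW : (x ^ 2 - 2 * (- C / 2 - r / 2 * S) * x + 1)
               * (x ^ 2 - 2 * (- C / 2 + r / 2 * S) * x + 1) = W).
  { transitivity ((x ^ 2 + C * x + 1) ^ 2 - (r * r) * (S * S) * x ^ 2); [field|].
    rewrite Hr. replace (S * S) with (1 - C * C) by lra. unfold W. ring. }
  assert (EY : (2 * (- C / 2 - r / 2 * S) - 1) * (2 * (- C / 2 + r / 2 * S) - 1)
               = 2 * (2 * C - 1) * (C + 1)).
  { transitivity ((1 + C) ^ 2 - (r * r) * (S * S)); [field|].
    rewrite Hr. replace (S * S) with (1 - C * C) by lra. ring. }
  assert (EN : (r / 2 * C - S / 2) * (2 * (- C / 2 + r / 2 * S) - 1)
                 * (x ^ 2 - 2 * (- C / 2 + r / 2 * S) * x + 1)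
             - (r / 2 * C + S / 2) * (2 * (- C / 2 - r / 2 * S) - 1)
                 * (x ^ 2 - 2 * (- C / 2 - r / 2 * S) * x + 1)
             = S * ((4 * C + 1) * (x ^ 2 + C * x + 1) + 3 * (1 + C) * x)).
  { transitivity (S * ((r * r) * C * (x ^ 2 + C * x + 1) + (1 + C) * (x ^ 2 + C * x + 1)
                       + (r * r) * (C * (1 + C) + S * S) * x)); [field|].
    rewrite Hr. replace (S * S) with (1 - C * C) by lra. ring. }
  set (qb := x ^ 2 - 2 * (- C / 2 - r / 2 * S) * x + 1) in *.
  set (qc := x ^ 2 - 2 * (- C / 2 + r / 2 * S) * x + 1) in *.
  set (yb := 2 * (- C / 2 - r / 2 * S) - 1) in *.
  set (yc := 2 * (- C / 2 + r / 2 * S) - 1) in *.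
  set (sb := r / 2 * C - S / 2) in *. set (sc := r / 2 * C + S / 2) in *.
  assert (HW : 0 < W) by (rewrite <- EW; now apply Rmult_lt_0_compat).
  transitivity (2 / (3 * (2 * C - 1)) * (S / qa)
    + 2 / 3 * ((sb * yc * qc - sc * yb * qb) / ((yb * yc) * (qb * qc)))
    - S * (4 * C ^ 2 - 1) / (1 + (4 * C ^ 3 - 3 * C)) * / (x ^ 2 - x + 1)).
  2:{ assert (1 + (4 * C ^ 3 - 3 * C) <> 0).
      { replace (1 + (4 * C ^ 3 - 3 * C)) with ((C + 1) * (2 * C - 1) ^ 2) by ring.
        apply Rgt_not_eq, Rmult_lt_0_compat; [|apply pow_lt]; lra. }
      field. repeat split; lra. }
  rewrite EN, EW, EY.
  replace (x ^ 6 - 2 * (4 * C ^ 3 - 3 * C) * x ^ 3 + 1) with (qa * W) by (unfold qa, W; ring).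
  replace (1 + (4 * C ^ 3 - 3 * C)) with ((C + 1) * (2 * C - 1) ^ 2) by ring.
  unfold qa, W in *. field. repeat split; lra.
Qed.

Lemma cos_sin_triple (a : R) :
  cos (3 * a) = 4 * cos a ^ 3 - 3 * cos a /\ sin (3 * a) = sin a * (4 * cos a ^ 2 - 1).
Proof.
  assert (H := sin2_cos2 a). unfold Rsqr in H.
  replace (3 * a) with (2 * a + a) by ring.
  rewrite cos_plus, sin_plus, cos_2a_cos, sin_2a. split; [|ring].
  transitivity (2 * cos a ^ 3 - cos a - 2 * cos a * (sin a * sin a)); [ring|].
  replace (sin a * sin a) with (1 - cos a * cos a) by lra. ring.
Qed.

Lemma cos_sin_2PI3 : cos (2 * PI / 3) = - (1 / 2) /\ sin (2 * PI / 3) = sqrt 3 / 2.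
Proof.
  replace (2 * PI / 3) with (2 * (PI / 3)) by field.
  split; [apply cos_sixth_turns|apply sin_sixth_turns].
Qed.

Lemma RInt_log_trinomial_derivative (th : R) : 0 < th < PI ->
  RInt (fun x => 2 * sin th * x ^ 3 / (trinomial th x * (x ^ 2 - x + 1))) 0 1 =
  2 * PI / sqrt 3 * (2 / 3 * sin ((PI - th) / 3) / (1 + 2 * cos ((PI - th) / 3))).
Proof.
  intros Ht. assert (HP := PI_RGT_0).
  assert (Hr : 0 < sqrt 3) by (apply sqrt_lt_R0; lra).
  assert (Hrr : sqrt 3 * sqrt 3 = 3) by (apply sqrt_sqrt; lra).
  set (r := sqrt 3) in *. set (a := th / 3).
  set (C := cos a). set (S := sin a).
  assert (HSC : S * S + C * C = 1) by apply sin2_cos2.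
  destruct cos_sin_2PI3 as [c23 s23].
  assert (Ecb : cos (2 * PI / 3 + a) = - C / 2 - r / 2 * S)
    by (rewrite cos_plus, c23, s23; fold C S r; field).
  assert (Esb : sin (2 * PI / 3 + a) = r / 2 * C - S / 2)
    by (rewrite sin_plus, c23, s23; fold C S r; field).
  assert (Ecc : cos (2 * PI / 3 - a) = - C / 2 + r / 2 * S)
    by (rewrite cos_minus, c23, s23; fold C S r; field).
  assert (Esc : sin (2 * PI / 3 - a) = r / 2 * C + S / 2)
    by (rewrite sin_minus, c23, s23; fold C S r; field).
  assert (HSa : 0 < S) by (apply sin_gt_0; unfold a; lra).
  assert (HSb : 0 < sin (2 * PI / 3 + a)) by (apply sin_gt_0; unfold a; lra).
  assert (HSc : 0 < sin (2 * PI / 3 - a)) by (apply sin_gt_0; unfold a; lra).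
  assert (HC : 1 < 2 * C).
  { assert (cos (PI / 3) < cos a) by (apply cos_decreasing_1; unfold a; lra).
    rewrite cos_PI3 in H. fold C in H. lra. }
  assert (Hyc : 2 * (- C / 2 + r / 2 * S) - 1 < 0).
  { rewrite <- Ecc. assert (cos (2 * PI / 3 - a) < cos (PI / 3))
      by (apply cos_decreasing_1; unfold a; lra).
    rewrite cos_PI3 in H. lra. }
  assert (Hyb : 2 * (- C / 2 - r / 2 * S) - 1 < 0) by nra.
  destruct (cos_sin_triple a) as [E3c E3s].
  replace (3 * a) with th in E3c, E3s by (unfold a; field). fold C S in E3c, E3s.
  assert (Ia := RInt_inv_quadratic a ltac:(unfold a; lra)).
  assert (Ib := RInt_inv_quadratic (2 * PI / 3 + a) ltac:(unfold a; lra)).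
  assert (Ic := RInt_inv_quadratic (2 * PI / 3 - a) ltac:(unfold a; lra)).
  assert (Id := RInt_inv_sqr_sub_add_1).
  fold C S r in Ia, Id. rewrite Ecb, Esb in Ib. rewrite Ecc, Esc in Ic.
  apply (is_RInt_scal (V := R_NormedModule) _ _ _ (2 / (3 * (2 * C - 1)))) in Ia.
  apply (is_RInt_scal (V := R_NormedModule) _ _ _
    (2 / (3 * (2 * (- C / 2 - r / 2 * S) - 1)))) in Ib.
  apply (is_RInt_scal (V := R_NormedModule) _ _ _
    (2 / (3 * (2 * (- C / 2 + r / 2 * S) - 1)))) in Ic.
  apply (is_RInt_scal (V := R_NormedModule) _ _ _
    (S * (4 * C ^ 2 - 1) / (1 + (4 * C ^ 3 - 3 * C)))) in Id.
  assert (I := is_RInt_minus (V := R_NormedModule) _ _ _ _ _ _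
    (is_RInt_minus (V := R_NormedModule) _ _ _ _ _ _
      (is_RInt_plus (V := R_NormedModule) _ _ _ _ _ _ Ia Ib) Ic) Id).
  apply (is_RInt_unique (V := R_CompleteNormedModule)) in I.
  transitivity ((2 / (3 * (2 * C - 1)) * ((PI - a) / 2)
    + 2 / (3 * (2 * (- C / 2 - r / 2 * S) - 1)) * ((PI - (2 * PI / 3 + a)) / 2)
    + - (2 / (3 * (2 * (- C / 2 + r / 2 * S) - 1)) * ((PI - (2 * PI / 3 - a)) / 2))
    + - (S * (4 * C ^ 2 - 1) / (1 + (4 * C ^ 3 - 3 * C)) * (2 * PI / (3 * r))))).
  - etransitivity; [|exact I]. apply (RInt_ext (V := R_CompleteNormedModule)).
    intros x _. unfold trinomial. rewrite E3c, E3s.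
    rewrite (trisection_partial_fractions C S r x); try assumption.
    + reflexivity.
    + now apply quadratic_cos_pos.
    + rewrite <- Ecb. now apply quadratic_cos_pos.
    + rewrite <- Ecc. now apply quadratic_cos_pos.
    + apply sqr_sub_add_1_pos.
  - match goal with |- ?u = ?v => change (@eq R u v) end.
    replace ((PI - th) / 3) with (PI / 3 - a) by (unfold a; field).
    rewrite sin_minus, cos_minus, sin_PI3, cos_PI3. fold C S r.
    assert (EY : (2 * (- C / 2 - r / 2 * S) - 1) * (2 * (- C / 2 + r / 2 * S) - 1)
               = 2 * (2 * C - 1) * (C + 1)).
    { transitivity ((1 + C) ^ 2 - (r * r) * (S * S)); [field|].
      rewrite Hrr. replace (S * S) with (1 - C * C) by lra. ring. }
    set (yb := 2 * (- C / 2 - r / 2 * S) - 1) in *.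
    set (yc := 2 * (- C / 2 + r / 2 * S) - 1) in *.
    transitivity (/ 3 * ((PI - a) / (2 * C - 1)
                         + ((PI / 3 - a) * yc - (PI / 3 + a) * yb) / (yb * yc))
                  - S * (4 * C ^ 2 - 1) / (1 + (4 * C ^ 3 - 3 * C)) * (2 * PI * r / (3 * (r * r)))).
    { assert (1 + (4 * C ^ 3 - 3 * C) <> 0).
      { replace (1 + (4 * C ^ 3 - 3 * C)) with ((C + 1) * (2 * C - 1) ^ 2) by ring.
        apply Rgt_not_eq, Rmult_lt_0_compat; [|apply pow_lt]; lra. }
      field. repeat split; lra. }
    (* The denominator [1 + 2 cos ((PI - th) / 3)] is [- yb]; expanding by [yc] produces the product
       evaluated in [EY]. *)
    transitivity (2 * PI / 3 * (((r * r) * C - r * S) / (r * r)) * (- yc / (yb * yc))).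
    2:{ replace (1 + 2 * (1 / 2 * C + r / 2 * S)) with (- yb) by (unfold yb; field).
        field. repeat split; lra. }
    rewrite EY, Hrr.
    replace (1 + (4 * C ^ 3 - 3 * C)) with ((C + 1) * (2 * C - 1) ^ 2) by ring.
    (* The terms in [a] cancel here, because [yb + yc = - 2 (C + 1)]. *)
    transitivity (PI * ((1 + C) - r * S * (4 * C + 1) / 3) / (3 * (2 * C - 1) * (C + 1))).
    { unfold yb, yc. field. lra. }
    transitivity (PI / 9 * (3 * C * (1 + C) - r * S * (4 * C + 1) + (r * r) * (S * S))
                  / ((2 * C - 1) * (C + 1))).
    { rewrite Hrr. replace (S * S) with (1 - C * C) by lra. field. lra. }
    unfold yc. field. lra.
Qed.

(** * Integration in th from the base point PI *)

Lemma is_RInt_ln_cube_add_1 :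
  is_RInt (fun x => ln (x ^ 3 + 1) / (x ^ 2 - x + 1)) 0 1
    (PI / sqrt 3 * ln 3 + ((trigamma (5 / 6) - trigamma (1 / 3)) / 12 - PI ^ 2 / 9)).
Proof.
  rewrite <- lncos_int_trigamma, <- RInt_ln_cube_add_1.
  apply (RInt_correct (V := R_CompleteNormedModule)).
  apply (ex_RInt_continuous (V := R_CompleteNormedModule)).
  intros x. rewrite Rmin_left, Rmax_right by lra. intros Hx.
  apply (ex_derive_continuous (K := R_AbsRing) (V := R_NormedModule)
    (fun x => ln (x ^ 3 + 1) / (x ^ 2 - x + 1)) x).
  assert (Hq := sqr_sub_add_1_pos x).
  assert (0 <= x ^ 3) by (apply pow_le; lra).
  auto_derive. simpl in *. repeat split; lra.
Qed.

(** The trinomial is the square [(x^3 + 1)^2] at [PI], which makes this angle the base point. *)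
Lemma log_trinomial_int_PI :
  log_trinomial_int PI =
  2 * (PI / sqrt 3 * ln 3 + ((trigamma (5 / 6) - trigamma (1 / 3)) / 12 - PI ^ 2 / 9)).
Proof.
  apply (is_RInt_unique (V := R_CompleteNormedModule)).
  eapply is_RInt_ext; [|exact (is_RInt_scal _ _ _ 2 _ is_RInt_ln_cube_add_1)].
  intros x. rewrite Rmin_left, Rmax_right by lra. intros Hx.
  assert (0 <= x ^ 3) by (apply pow_le; lra).
  unfold trinomial. rewrite cos_PI.
  replace (x ^ 6 - 2 * -1 * x ^ 3 + 1) with ((x ^ 3 + 1) * (x ^ 3 + 1)) by ring.
  rewrite ln_mult by lra. unfold scal; simpl; unfold mult; simpl. unfold Rdiv. ring.
Qed.

Lemma log_trinomial_int_eq (th : R) : 0 < th <= PI ->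
  log_trinomial_int th =
  (trigamma (5 / 6) - trigamma (1 / 3)) / 6 - 2 * PI ^ 2 / 9
  + 2 * PI / sqrt 3 * ln (1 + 2 * cos ((PI - th) / 3)).
Proof.
  intros Ht. assert (HP := PI_RGT_0).
  assert (Hr : 0 < sqrt 3) by (apply sqrt_lt_R0; lra).
  assert (H := derive_zero_constant
    (fun t => log_trinomial_int t + - (2 * PI / sqrt 3 * ln (1 + 2 * cos ((PI - t) / 3)))) th PI
    ltac:(lra)).
  cbv beta in H. rewrite log_trinomial_int_PI in H.
  replace ((PI - PI) / 3) with 0 in H by field. rewrite cos_0 in H.
  replace (1 + 2 * 1) with 3 in H by ring.
  match type of H with ?P -> _ => assert (HH : P) end.
  2:{ apply H in HH.
      transitivity (2 * (PI / sqrt 3 * ln 3 + ((trigamma (5 / 6) - trigamma (1 / 3)) / 12 - PI ^ 2 / 9))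
        + - (2 * PI / sqrt 3 * ln 3) + 2 * PI / sqrt 3 * ln (1 + 2 * cos ((PI - th) / 3))).
      - rewrite HH. ring.
      - field. lra. }
  clear H. intros t Htt.
  set (d := 2 * PI / sqrt 3 * (2 / 3 * sin ((PI - t) / 3) / (1 + 2 * cos ((PI - t) / 3)))).
  assert (Hc : 0 < cos ((PI - t) / 3)) by (apply cos_gt_0; lra).
  replace 0 with (d + - d) by ring.
  apply (is_derive_plus (V := R_NormedModule) log_trinomial_int
    (fun t => - (2 * PI / sqrt 3 * ln (1 + 2 * cos ((PI - t) / 3))))).
  - replace d with (RInt (fun x => 2 * sin t * x ^ 3 / (trinomial t x * (x ^ 2 - x + 1))) 0 1).
    + apply is_derive_log_trinomial_int. lra.
    (* The partial fractions require [t < PI]; at [t = PI] both sides contain a vanishing sine. *)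
    + destruct (Rle_lt_or_eq_dec t PI (proj2 Htt)) as [Hlt | ->].
      * apply RInt_log_trinomial_derivative. lra.
      * unfold d. replace ((PI - PI) / 3) with 0 by field. rewrite sin_PI, sin_0.
        rewrite (RInt_ext (V := R_CompleteNormedModule) _ (fun _ => 0)).
        -- rewrite (RInt_const (V := R_CompleteNormedModule)).
           unfold scal; simpl; unfold mult; simpl. unfold Rdiv. ring.
        -- intros x _. unfold Rdiv. rewrite Rmult_0_r, !Rmult_0_l. reflexivity.
  - unfold d. auto_derive; [unfold Rminus, Rdiv in Hc; lra|].
    unfold Rminus, Rdiv in *. field. lra.
Qed.

(* With [b = (PI - th) / 6] one has [asin (sqrt ((1 + cos th) / 2)) = 3 b], and
   [2 cos (2 b) + 1 = 3 - 4 sin^2 b = sin (3 b) / sin b] collapses the three logarithms. *)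
Lemma log_combination (th : R) : 0 < th < PI ->
  2 * ln (sin (1 / 3 * asin (sqrt ((cos th + 1) / 2))))
  - ln (2 * cos (2 / 3 * asin (sqrt ((1 + cos th) / 2))) + 1)
  - ln (cos th + 1) = - ln 2 - 3 * ln (1 + 2 * cos ((PI - th) / 3)).
Proof.
  intros Ht. set (b := (PI - th) / 6).
  assert (Hb : 0 < b) by (unfold b; lra).
  assert (Hsb : 0 < sin b) by (apply sin_gt_0; unfold b; lra).
  assert (Hs3 : 0 < sin (3 * b)) by (apply sin_gt_0; unfold b; lra).
  assert (Ec : cos th + 1 = 2 * (sin (3 * b) * sin (3 * b))).
  { replace th with (PI - 2 * (3 * b)) by (unfold b; field).
    rewrite Rtrigo_facts.cos_pi_minus, cos_2a_sin. ring. }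
  assert (Ea : asin (sqrt ((cos th + 1) / 2)) = 3 * b).
  { rewrite Ec. replace (2 * (sin (3 * b) * sin (3 * b)) / 2) with (sin (3 * b) * sin (3 * b)) by field.
    rewrite sqrt_square by lra. apply asin_sin. unfold b; lra. }
  rewrite (Rplus_comm 1 (cos th)), Ea.
  replace (1 / 3 * (3 * b)) with b by field.
  replace (2 / 3 * (3 * b)) with (2 * b) by field.
  replace ((PI - th) / 3) with (2 * b) by (unfold b; field).
  assert (E3 : sin (3 * b) = sin b * (2 * cos (2 * b) + 1)).
  { rewrite (proj2 (cos_sin_triple b)), cos_2a_cos. ring. }
  assert (Hc : 0 < 2 * cos (2 * b) + 1).
  { apply Rmult_lt_reg_l with (sin b); [assumption|]. rewrite Rmult_0_r, <- E3. assumption. }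
  rewrite Ec, !ln_mult, E3, ln_mult by
    (try assumption; try lra; try (apply Rmult_lt_0_compat; assumption)).
  rewrite (Rplus_comm 1). ring.
Qed.

Lemma is_RInt_log_trinomial (th : R) : 0 < th < PI ->
  is_RInt (fun x => ln ((x ^ 3) ^ 2 - 2 * cos th * x ^ 3 + 1) / (x ^ 2 - x + 1)) 0 1
    ((trigamma (5 / 6) - trigamma (1 / 3)) / 6 - 2 * PI ^ 2 / 9
     + 2 * PI / sqrt 3 * ln (1 + 2 * cos ((PI - th) / 3))).
Proof.
  intros Ht. rewrite <- log_trinomial_int_eq by lra.
  apply is_RInt_ext with (fun x => ln (trinomial th x) / (x ^ 2 - x + 1)).
  - intros x _. unfold trinomial. do 3 f_equal. ring.
  - apply (RInt_correct (V := R_CompleteNormedModule)), ex_RInt_ln_trinomial. lra.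
Qed.

(** * Summation over the angles and conclusion *)

Lemma is_RInt_sum_lt (n : nat) (f : nat -> R -> R) (v : nat -> R) (a b : R) :
  (forall k, (k < n)%nat -> is_RInt (f k) a b (v k)) ->
  is_RInt (fun x => sum_lt n (fun k => f k x)) a b (sum_lt n v).
Proof.
  induction n as [|n IH]; intros H.
  - assert (H0 := is_RInt_const (V := R_NormedModule) a b 0).
    unfold scal in H0; simpl in H0; unfold mult in H0; simpl in H0.
    rewrite Rmult_0_r in H0. exact H0.
  - rewrite sum_lt_S. apply is_RInt_ext with (fun x => sum_lt n (fun k => f k x) + f n x).
    { intros x _. now rewrite sum_lt_S. }
    apply (is_RInt_plus (V := R_NormedModule)); [apply IH; intros|]; apply H; lia.
Qed.

Lemma sum_lt_log_combination (m K : nat) : (2 * K <= m)%nat ->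
  2 * sum_lt K (fun k => ln (sin (1 / 3 * asin (sqrt ((phi m k + 1) / 2)))))
  - sum_lt K (fun k => ln (2 * cos (2 / 3 * asin (sqrt ((1 + phi m k) / 2))) + 1))
  - sum_lt K (fun k => ln (phi m k + 1)) =
  - INR K * ln 2
  - 3 * sum_lt K (fun k => ln (1 + 2 * cos ((PI - (2 * INR k + 1) * PI / INR m) / 3))).
Proof.
  intros HK. induction K as [|K IH]; [unfold sum_lt; simpl; ring|].
  rewrite !sum_lt_S, S_INR.
  assert (H := log_combination _ (odd_angle_bounds m K ltac:(lia))). fold (phi m K) in H.
  specialize (IH ltac:(lia)). lra.
Qed.

(** Keeping [m] and [K] separate serves both parities. The summand [INR K * ln 2] undoes the
    [- ln 2] of each [log_combination]; it becomes the [ln 2] term of the theorem, with [2 K] equal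
    to [m] or [m - 1]. *)
Lemma is_RInt_sum_log_quadratic (m K : nat) : (2 * K <= m)%nat ->
  is_RInt (fun x => sum_lt K (fun k =>
      ln ((x ^ 3) ^ 2 - 2 * phi m k * x ^ 3 + 1) / (x ^ 2 - x + 1))) 0 1
    (INR K * ((trigamma (5 / 6) - trigamma (1 / 3)) / 6 - 2 * PI ^ 2 / 9)
     - 2 * PI * sqrt 3 / 9 *
       (2 * sum_lt K (fun k => ln (sin (1 / 3 * asin (sqrt ((phi m k + 1) / 2)))))
        - sum_lt K (fun k => ln (2 * cos (2 / 3 * asin (sqrt ((1 + phi m k) / 2))) + 1))
        - sum_lt K (fun k => ln (phi m k + 1)) + INR K * ln 2)).
Proof.
  intros HK. rewrite sum_lt_log_combination by assumption.
  set (c := (trigamma (5 / 6) - trigamma (1 / 3)) / 6 - 2 * PI ^ 2 / 9).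
  set (w := fun k => ln (1 + 2 * cos ((PI - (2 * INR k + 1) * PI / INR m) / 3))).
  replace (INR K * c - 2 * PI * sqrt 3 / 9 * (- INR K * ln 2 - 3 * sum_lt K w + INR K * ln 2))
    with (sum_lt K (fun k => c + 2 * PI / sqrt 3 * w k)).
  - apply is_RInt_sum_lt. intros k Hk.
    apply is_RInt_log_trinomial, odd_angle_bounds. lia.
  - assert (Hr : 0 < sqrt 3) by (apply sqrt_lt_R0; lra).
    transitivity (INR K * c + 2 * PI / sqrt 3 * sum_lt K w).
    + clear HK. clearbody w. induction K as [|K IH]; [unfold sum_lt; simpl; ring|].
      rewrite !sum_lt_S, S_INR, IH. ring.
    + replace (2 * PI * sqrt 3 / 9) with (2 * PI * (sqrt 3 * sqrt 3) / (9 * sqrt 3)) by (field; lra).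
      rewrite sqrt_sqrt by lra. field. lra.
Qed.

Lemma sum_lt_div (K : nat) (f : nat -> R) (d : R) :
  sum_lt K (fun k => f k / d) = sum_lt K f / d.
Proof.
  unfold Rdiv. rewrite Rmult_comm, <- sum_lt_scal. apply sum_lt_ext. intros; ring.
Qed.

Lemma integrand_simpl (x l : R) : 0 < x -> (x + 1) * l / (x ^ 3 + 1) = l / (x ^ 2 - x + 1).
Proof.
  intros Hx. assert (Hq := sqr_sub_add_1_pos x).
  replace (x ^ 3 + 1) with ((x + 1) * (x ^ 2 - x + 1)) by ring.
  field. split; lra.
Qed.

Lemma is_RInt_eq (f g : R -> R) (a b u v : R) :
  a <= b -> is_RInt f a b u -> u = v -> (forall x, a < x < b -> f x = g x) ->
  is_RInt g a b v.
Proof.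
  intros Hab Hf <- E. apply is_RInt_ext with f; [|exact Hf].
  intros x. rewrite Rmin_left, Rmax_right by assumption. apply E.
Qed.

Theorem theorem2p6 :
  (forall m : nat, (2 <= m)%nat -> Nat.Even m ->
    is_RInt (fun x => (x + 1) * ln (x ^ (3 * m) + 1) / (x ^ 3 + 1)) 0 1
      (INR m / 12 * (trigamma (5 / 6) - trigamma (1 / 3))
       - PI ^ 2 * INR m / 9
       - PI * INR m * sqrt 3 / 9 * ln 2
       - 2 * PI * sqrt 3 / 9 *
         (2 * sum_lt (m / 2)
                (fun k => ln (sin (1 / 3 * asin (sqrt ((phi m k + 1) / 2)))))
          - sum_lt (m / 2)
              (fun k => ln (2 * cos (2 / 3 * asin (sqrt ((1 + phi m k) / 2))) + 1))
          - sum_lt (m / 2) (fun k => ln (phi m k + 1)))))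
  /\
  (forall m : nat, (1 <= m)%nat -> Nat.Odd m ->
    is_RInt (fun x => (x + 1) * ln (x ^ (3 * m) + 1) / (x ^ 3 + 1)) 0 1
      (INR m / 12 * (trigamma (5 / 6) - trigamma (1 / 3))
       - PI ^ 2 * INR m / 9
       + PI * sqrt 3 / 3 * ln 3
       - PI * (INR m - 1) * sqrt 3 / 9 * ln 2
       - 2 * PI * sqrt 3 / 9 *
         (2 * sum_lt ((m - 1) / 2)
                (fun k => ln (sin (1 / 3 * asin (sqrt ((phi m k + 1) / 2)))))
          - sum_lt ((m - 1) / 2)
              (fun k => ln (2 * cos (2 / 3 * asin (sqrt ((1 + phi m k) / 2))) + 1))
          - sum_lt ((m - 1) / 2) (fun k => ln (1 + phi m k))))).
Proof.
  split; intros m Hm [K HK]; subst m.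
  - replace (2 * K / 2)%nat with K by (rewrite Nat.mul_comm; symmetry; apply Nat.div_mul; lia).
    replace (INR (2 * K)) with (2 * INR K) by (rewrite mult_INR; reflexivity).
    apply (is_RInt_eq _ _ _ _ _ _ Rle_0_1 (is_RInt_sum_log_quadratic (2 * K) K (le_n _)));
      [field|]. intros x Hx. symmetry.
    rewrite integrand_simpl by lra.
    rewrite pow_mult, ln_pow_even_add_1; [|apply pow_lt; lra|lia].
    now rewrite sum_lt_div.
  - replace ((2 * K + 1 - 1) / 2)%nat with K
      by (rewrite Nat.add_sub, Nat.mul_comm; symmetry; apply Nat.div_mul; lia).
    replace (INR (2 * K + 1)) with (2 * INR K + 1) by (rewrite plus_INR, mult_INR; reflexivity).
    rewrite (sum_lt_ext K (fun k => ln (1 + phi (2 * K + 1) k)) (fun k => ln (phi (2 * K + 1) k + 1)))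
      by (intros; f_equal; ring).
    (* The unpaired root [y = -1] contributes the integral of [ln (x^3 + 1) / (x^2 - x + 1)], the
       source of the [ln 3] term. *)
    apply (is_RInt_eq _ _ _ _ _ _ Rle_0_1 (is_RInt_plus (V := R_NormedModule) _ _ _ _ _ _
      (is_RInt_sum_log_quadratic (2 * K + 1) K ltac:(lia)) is_RInt_ln_cube_add_1)).
    { assert (Hr : 0 < sqrt 3) by (apply sqrt_lt_R0; lra).
      replace (PI / sqrt 3) with (PI * sqrt 3 / (sqrt 3 * sqrt 3)) by (field; lra).
      rewrite sqrt_sqrt by lra. unfold plus; simpl. field. }
    intros x Hx. symmetry.
    rewrite integrand_simpl by lra.
    rewrite pow_mult, ln_pow_odd_add_1 by (apply pow_lt; lra).
    rewrite sum_lt_div. apply Rdiv_plus_distr.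
Qed.
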